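(* For any positive number $\delta$ there exists a factor map between dynamical systems $\pi:(X,T)\to(Y,S)$ satisfying $$\mathrm{mdim}(X,T)=1,\qquad \mathrm{mdim}(Y,S)<\delta,\qquad \mathrm{mdim}(\pi,T)=0.$$
   Context: ''Simplicial complex'' always means a finite simplicial complex (identified with its geometric realization). For a metric space $(X,d)$, a topological space $Y$ and $\varepsilon>0$, a continuous map $f:X\to Y$ is an $\varepsilon$-embedding if $\mathrm{Diam}\, f^{-1}(y)<\varepsilon$ for all $y\in Y$. The $\varepsilon$-width dimension $\mathrm{Widim}_\varepsilon(X,d)$ is the minimum integer $n\ge 0$ such that there exist an $n$-dimensional simplicial complex $P$ and an $\varepsilon$-embedding $f:X\to P$. Subsets of metric spaces carry the restricted metric. A dynamical system $(X,T)$ is a compact metrizable space $X$ with a homeomorphism $T:X\to X$. Given a metric $d$ on $X$ compatible with the topology, for each natural number $N$ set $d_N(x,y)=\max_{0\le n<N} d(T^nx,T^ny)$. The mean dimension is $$\mathrm{mdim}(X,T)=\lim_{\varepsilon\to 0}\left(\lim_{N\to\infty}\frac{\mathrm{Widim}_\varepsilon(X,d_N)}{N}\right)\in[0,\infty],$$ which is independent of the choice of $d$. A factor map $\pi:(X,T)\to(Y,S)$ between dynamical systems is a continuous surjection $\pi:X\to Y$ with $\pi\circ T=S\circ\pi$. Its relative mean dimension is $$\mathrm{mdim}(\pi,T)=\lim_{\varepsilon\to 0}\left(\lim_{N\to\infty}\frac{\sup_{y\in Y}\mathrm{Widim}_\varepsilon(\pi^{-1}(y),d_N)}{N}\right)\in[0,\infty]$$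 (the limits exist by subadditivity in $N$ and monotonicity in $\varepsilon$). *)

(* Defs.v *)
From HB Require Import structures.
From mathcomp Require Import all_boot all_order all_algebra.
From mathcomp Require Import all_classical all_reals all_analysis.

Set Implicit Arguments.
Unset Strict Implicit.
Unset Printing Implicit Defensive.

Import Order.TTheory GRing.Theory Num.Theory.
Import numFieldNormedType.Exports.

Local Open Scope classical_set_scope.
Local Open Scope ring_scope.
Local Open Scope ereal_scope.

(* The vertex set of a finite complex is taken to be 'I_k; not every element
   of 'I_k needs to span a simplex. *)
Record simplicial_complex (k : nat) := SimplicialComplex {
  simplices :> {set {set 'I_k}};
  simplices_neq0 : finset.set0 \notin simplices;
  simplices_sub : forall s t : {set 'I_k},
    s \in simplices -> t \subset s -> t != finset.set0 -> t \in simplices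
}.

(* The empty complex has no dimension in nat. *)
Definition has_dimension (k : nat) (K : simplicial_complex k) (n : nat) : Prop :=
  (\max_(s in simplices K) #|s|)%N = n.+1.

(* Barycentric coordinates in R^k; for a finite complex the topology induced
   from R^k is the usual one. *)
Definition realization (R : realType) (k : nat) (K : simplicial_complex k) :
    set 'rV[R]_k :=
  [set x | [/\ forall i, (0 <= x ord0 i)%R,
               (\sum_(i < k) x ord0 i)%R = 1%R &
               finset (fun i => x ord0 i != 0%R) \in simplices K]].

Definition is_metric (R : realType) (X : Type) (d : X -> X -> R) : Prop :=
  [/\ forall x y, (0 <= d x y)%R,
      forall x y, d x y = 0%R <-> x = y,
      forall x y, d x y = d y x &
      forall x y z, (d x z <= d x y + d y z)%R].

Definition compatible_metric (R : realType) (X : topologicalType)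
    (d : X -> X -> R) : Prop :=
  is_metric d /\
  forall (x : X) (U : set X),
    nbhs x U <-> exists2 e : R, (0 < e)%R & [set y | (d x y < e)%R] `<=` U.

(* Extended-real valued; the diameter of the empty set is -oo. *)
Definition diam (R : realType) (X : Type) (d : X -> X -> R) (A : set X) :
    \bar R :=
  ereal_sup [set (d p.1 p.2)%:E | p in A `*` A].

(* f is only relevant on A; P is a subspace of Z. *)
Definition eps_embedding (R : realType) (X Z : topologicalType)
    (d : X -> X -> R) (e : R) (A : set X) (P : set Z) (f : X -> Z) : Prop :=
  [/\ {within A, continuous f},
      f @` A `<=` P &
      forall z, P z -> diam d (A `&` f @^-1` [set z]) < e%:E].

(* Widim_e(A, d) for a subset A of X, where d is a metric compatible with the
   topology of X. The infimum over a set of naturals is a minimum; it would be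
   +oo if there were no e-embedding, which does not happen for A compact. *)
Definition widim (R : realType) (X : topologicalType) (d : X -> X -> R)
    (e : R) (A : set X) : \bar R :=
  ereal_inf [set (n%:R)%:E | n in
    [set n : nat | exists (k : nat) (K : simplicial_complex k),
       has_dimension K n /\
       exists f : X -> 'rV[R]_k, eps_embedding d e A (@realization R k K) f]].

Definition orbit_metric (R : realType) (X : Type) (T : X -> X)
    (d : X -> X -> R) (N : nat) (x y : X) : R :=
  (\big[Num.max/0]_(n < N) d (iter n T x) (iter n T y))%R.

Definition homeomorphism (X Y : topologicalType) (f : X -> Y) : Prop :=
  exists g : Y -> X,
    [/\ continuous f, continuous g, cancel f g & cancel g f].

Definition dynamical_system (R : realType) (X : topologicalType) (T : X -> X) :
    Prop :=
  [/\ compact [set: X],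
      exists d : X -> X -> R, compatible_metric d &
      homeomorphism T].

Definition factor_map (X Y : topologicalType) (T : X -> X) (S : Y -> Y)
    (pi : X -> Y) : Prop :=
  [/\ continuous pi,
      set_surj [set: X] [set: Y] pi &
      forall x, pi (T x) = S (pi x)].

Definition mdim (R : realType) (X : topologicalType) (T : X -> X)
    (d : X -> X -> R) : \bar R :=
  lim ((fun e : R =>
    limn (fun N : nat =>
      widim (orbit_metric T d N) e [set: X] / (N%:R)%:E)) @ (0%R : R)^'+).

Definition rel_mdim (R : realType) (X Y : topologicalType) (T : X -> X)
    (pi : X -> Y) (d : X -> X -> R) : \bar R :=
  lim ((fun e : R =>
    limn (fun N : nat =>
      ereal_sup [set widim (orbit_metric T d N) e (pi @^-1` [set y])
                | y in [set: Y]] / (N%:R)%:E)) @ (0%R : R)^'+).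

(* Main.v *)
Require Import Defs.
From HB Require Import structures.
From mathcomp Require Import all_boot all_order all_algebra.
From mathcomp Require Import all_classical all_reals all_analysis.
From mathcomp Require Import perm lra zify.

Set Implicit Arguments.
Unset Strict Implicit.
Unset Printing Implicit Defensive.

Import Order.TTheory GRing.Theory Num.Theory.
Import numFieldNormedType.Exports.

Local Open Scope classical_set_scope.
Local Open Scope ring_scope.

(* Idea. X is the full shift over [0,1] together with, for every n, a periodic
   marker cutting the sequence into blocks of length N_n = (n+1) m_n, where
   m_n = C 2^(n+1). On a block (x_t), let tau be a triangle wave with n+1 pieces;
   Y remembers, besides the markers, only the n order statistics of (tau(x_t))
   of ranks m_n, ..., n m_n.
   This costs n parameters per N_n coordinates, so mdim Y <= sum_n 1/m_n
   <= 1/C.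

   On a fibre of X -> Y two consecutive order statistics a < b are known, and at
   most m_n of the values tau(x_t) lie in ]a, b[. Collapsing tau <= a and
   tau >= b to points keeps track of x_t up to 2/(n+1), and at most m_n of the
   collapsed coordinates of a block are not 0 or 1: the fibres have mean
   dimension at most m_n/N_n = 1/(n+1) at a scale tending to 0 with n.

   Widths are counted through order types. If u_1, ..., u_D : A -> [0,1] take at
   each point at most n distinct values in ]0,1[, the Kuhn triangulation of the
   D-cube maps A into a complex of dimension n. Conversely the partial sums of
   the barycentric coordinates of an n-dimensional complex have at most n
   distinct values in ]0,1[. This yields covers of multiplicity n+1, and the
   lower bound mdim X >= 1 is Lebesgue's covering theorem for the cube, obtained
   from a signed sum of determinants over all simplices of a subdivided cube,
   which only depends on boundary values. *)

(** * Lebesgue covering: a determinantal Sperner lemma *)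

Section Kuhn.
Variable (R : comNzRingType).

(* The [k]-th vertex of the Kuhn simplex with base [v], in which the coordinates
   are increased in the order [s]. *)
Definition chain_vertex (N m : nat) (v : {ffun 'I_N -> 'I_m}) (s : 'S_N)
  (k : nat) : {ffun 'I_N -> nat} := [ffun i => (v i + (s i < k))%N].

(* Laplace with a null expansion subtracted, so that each term has the form of
   a cochain evaluated on a facet. *)
Lemma det_facets (N : nat) (B : 'M[R]_N.+1) (i0 i1 : 'I_N.+1) :
  i0 != i1 -> (forall k, B i1 k = 1) ->
  \det B = - \sum_(k < N.+1) (-1) ^+ (i0 + k) *
    ((\sum_(j < N) B i0 (lift k j)) * \det (row' i0 (col' k B))).
Proof.
move=> i01 B1; rewrite (expand_det_row B i0).
pose B' := \matrix_(i, k) (if i == i0 then 1 else B i k).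
have B'0 : \det B' = 0.
  apply: (determinant_alternate i01) => k; rewrite !mxE eqxx.
  by rewrite eq_sym (negPf i01) B1.
have E k : cofactor B' i0 k = cofactor B i0 k.
  rewrite /cofactor; congr (_ * \det _); apply/matrixP => i j.
  by rewrite !mxE eq_sym (negPf (neq_lift _ _)).
have S0 : \sum_k cofactor B i0 k = 0.
  rewrite -[RHS]B'0 (expand_det_row B' i0); apply: eq_bigr => k _.
  by rewrite E mxE eqxx mul1r.
have -> : \sum_j B i0 j * cofactor B i0 j =
   - \sum_k (\sum_j B i0 j - B i0 k) * cofactor B i0 k.
  under [in RHS]eq_bigr do rewrite mulrBl.
  by rewrite sumrB -mulr_sumr S0 mulr0 sub0r opprK.
congr (- _); apply: eq_bigr => k _.
rewrite /cofactor mulrCA; congr (_ * (_ * _)).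
rewrite (bigD1 k) //= [X in X - _]addrC addrK.
rewrite (reindex_omap (lift k) (unlift k)) /=; last first.
  by move=> j jk; case: unliftP jk => [u -> //|->]; rewrite eqxx.
by apply: eq_bigl => j; rewrite liftK eqxx eq_sym neq_lift.
Qed.

Implicit Types n m : nat.

(** Exchanging the steps [k - 1] and [k] of the order [s] moves only the [k]-th vertex, so the facet
    opposite to it occurs twice, with opposite signs. *)
Lemma chain_interior_face n m (v : {ffun 'I_n.+1 -> 'I_m})
    (C : {ffun 'I_n.+1 -> {ffun 'I_n.+1 -> nat}} -> R) (k : 'I_n.+2) :
  k != ord0 -> k != ord_max ->
  \sum_s (-1) ^+ odd_perm s * C [ffun j => chain_vertex v s (lift k j)] = 0.
Proof.
move=> k0 kn.
have k_gt0 : (0 < k)%N by rewrite lt0n.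
have k_le : (k < n.+1)%N.
  by rewrite ltn_neqAle -ltnS ltn_ord andbT; apply: contraNneq kn => e; apply/eqP/val_inj.
pose a : 'I_n.+1 := Ordinal (leq_ltn_trans (leq_pred k) k_le).
pose b : 'I_n.+1 := Ordinal k_le.
have ab : a != b by rewrite -(inj_eq val_inj) /= neq_ltn prednK // leqnn.
pose F s := (-1) ^+ odd_perm s * C [ffun j => chain_vertex v s (lift k j)].
rewrite (bigID (fun s : 'S_n.+1 => odd_perm s)) /=.
rewrite (reindex_inj (mulIg (tperm a b))) /=.
under eq_bigl do rewrite odd_permM odd_tperm ab addbT.
rewrite -big_split big1 //= => s _; rewrite odd_permM odd_tperm ab addbT.
suff -> : [ffun j => chain_vertex v (s * tperm a b) (lift k j)] =
    [ffun j => chain_vertex v s (lift k j)].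
  by rewrite signrN mulNr addNr.
apply/ffunP => j; rewrite !ffunE; apply/ffunP => i; rewrite !ffunE permM.
congr (_ + nat_of_bool _)%N; have kj : nat_of_ord (lift k j) != k.
  by rewrite eq_sym (inj_eq val_inj) neq_lift.
have e : (k.-1 < lift k j)%N = (k < lift k j)%N.
  by rewrite prednK // leq_eqVlt eq_sym (negPf kj).
by case: tpermP => [-> | -> |//].
Qed.

(** The facet opposite the first vertex is also opposite the last vertex of a simplex in the next
    cube: the direction raised first moves to the end of the order, by a cycle of sign
    [(-1) ^+ n]. *)
Lemma chain_end_faces n m
    (C : {ffun 'I_n.+1 -> {ffun 'I_n.+1 -> nat}} -> R) :
  (forall i (w : {ffun 'I_n.+1 -> {ffun 'I_n.+1 -> nat}}),
      (forall j, w j i = 0%N) \/ (forall j, w j i = m) -> C w = 0) ->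
  \sum_(v : {ffun 'I_n.+1 -> 'I_m}) \sum_s (-1) ^+ odd_perm s *
     C [ffun j => chain_vertex v s (lift ord0 j)] =
  (-1) ^+ n * \sum_(v : {ffun 'I_n.+1 -> 'I_m}) \sum_s (-1) ^+ odd_perm s *
     C [ffun j => chain_vertex v s (lift ord_max j)].
Proof.
move=> C0.
rewrite mulr_sumr exchange_big [RHS](eq_bigr (fun v => \sum_s (-1) ^+ n * ((-1) ^+ odd_perm s *
     C [ffun j => chain_vertex v s (lift ord_max j)]))) => [|v _]; last by rewrite mulr_sumr.
rewrite [RHS]exchange_big.
pose c : 'S_n.+1 := lift_perm ord0 ord_max 1.
rewrite [RHS](reindex_inj (mulIg c)) /=; apply: eq_bigr => s _.
rewrite -!mulr_sumr mulrA odd_permM odd_lift_perm odd_perm1 /= addbF.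
rewrite [X in _ (+) X]/= signr_addb signr_odd mulrCA -exprD addnn -mul2n exprM sqrrN !expr1n mulr1.
congr (_ * _).
pose i0 := s^-1%g ord0.
have si0 : s i0 = ord0 by rewrite permKV.
case: m C0 => [|m] C0.
  by rewrite !big1 // => v; case: (v ord0).
(* The coordinate [i0] of the base is raised cyclically; when it wraps around, both facets lie on
   the boundary of the large cube, where [C] vanishes. *)
pose rot (f : 'I_m.+1 -> 'I_m.+1) (v : {ffun 'I_n.+1 -> 'I_m.+1}) : {ffun 'I_n.+1 -> 'I_m.+1} :=
  [ffun i => if i == i0 then f (v i) else v i].
have rotK : cancel (rot (@ordS m.+1)) (rot (@ord_pred m.+1)).
  move=> v; apply/ffunP => i; rewrite !ffunE.
  by case: eqP => // _; rewrite ordSK.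
rewrite [RHS](reindex_inj (can_inj rotK)); apply: eq_bigr => v _ /=.
have E (t : 'I_n.+1) (j : 'I_n.+1) : (c t < lift ord_max j)%N = (t != ord0) && (t < lift ord0 j)%N.
  rewrite lift_max lift0 ltnS; case: (unliftP ord0 t) => [u|] ->.
    by rewrite lift_perm_lift perm1 lift_max lift0 eq_sym neq_lift.
  rewrite lift_perm_id. by rewrite eqxx /= ltnNge -ltnS ltn_ord.
have [vm|vm] := eqVneq (v i0) ord_max.
  rewrite !(C0 i0) //; [left|right] => j; rewrite !ffunE ?eqxx.
    by rewrite permM si0 E vm /= modnn.
  by rewrite si0 vm /= addn1.
congr C; apply/ffunP => j; rewrite !ffunE; apply/ffunP => i; rewrite !ffunE permM E.
have [->|ii0] := eqVneq i i0.
  rewrite ?eqxx si0 /= addn1 ?addn0 modn_small // ltnS ltn_neqAle -ltnS ltn_ord andbT.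
  by apply: contraNneq vm => e; apply/eqP/val_inj.
by congr (_ + nat_of_bool _)%N; rewrite -{1}si0 (inj_eq perm_inj) ii0.
Qed.

Definition chain_mx n m (F : 'I_n.+1 -> {ffun 'I_n -> nat} -> R)
    (v : {ffun 'I_n -> 'I_m}) (s : 'S_n) : 'M[R]_n.+1 :=
  \matrix_(j, k) F j (chain_vertex v s k).

(** When the row [F ord0] is constantly 1, each determinant is [n!] times the signed volume of the
    image of a Kuhn simplex, and the sign of [s] is the orientation of that simplex: a discrete
    degree. *)
Definition degree_sum n m (F : 'I_n.+1 -> {ffun 'I_n -> nat} -> R) : R :=
  \sum_(v : {ffun 'I_n -> 'I_m}) \sum_s (-1) ^+ odd_perm s *
    \det (chain_mx F v s).

(* A discrete Stokes formula: interior facets cancel in pairs, and on a boundary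
   facet either the row [i0] vanishes or the row [i] is a multiple of the row of
   ones. *)
Lemma degree_sum_eq0 n m (F : 'I_n.+1 -> {ffun 'I_n -> nat} -> R) (i0 : 'I_n) :
  (forall w, F ord0 w = 1) ->
  (forall w : {ffun 'I_n -> nat}, w i0 = 0%N \/ w i0 = m -> F (lift ord0 i0) w = 0) ->
  (forall i, i != i0 -> exists c0 cm, forall w : {ffun 'I_n -> nat},
     (w i = 0%N -> F (lift ord0 i) w = c0) /\
     (w i = m -> F (lift ord0 i) w = cm)) ->
  degree_sum m F = 0.
Proof.
case: n F i0 => [|n] F i0; first by case: i0.
move=> F0 Fi0 Fi; set j0 := lift ord0 i0.
pose C (w : {ffun 'I_n.+1 -> {ffun 'I_n.+1 -> nat}}) : R :=
  (\sum_j F j0 (w j)) * \det (\matrix_(a < n.+1, j < n.+1) F (lift j0 a) (w j)).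
have E v s : \det (chain_mx F v s) = - \sum_(k < n.+2) (-1) ^+ (j0 + k) *
     C [ffun j => @chain_vertex n.+1 m v s (lift k j)].
  have j00 : j0 != ord0 by rewrite eq_sym neq_lift.
  have F01 k : chain_mx F v s ord0 k = 1 by rewrite mxE F0.
  rewrite (det_facets j00 F01).
  congr (- _); apply: eq_bigr => k _; congr (_ * _); rewrite /C; congr (_ * _).
    by apply: eq_bigr => j _; rewrite !mxE ffunE.
  congr determinant.
  by apply/matrixP => a j; rewrite !mxE ffunE.
have C0 i (w : {ffun 'I_n.+1 -> {ffun 'I_n.+1 -> nat}}) :
    (forall j, w j i = 0%N) \/ (forall j, w j i = m) -> C w = 0.
  move=> wi; have [ii0|ii0] := eqVneq i i0.
    rewrite /C big1 ?mul0r // => j _; apply: Fi0; rewrite -ii0.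
    by case: wi => wi; [left|right].
  have [c0 [cm Fc]] := Fi i ii0.
  have [c wc] : exists c, forall j, F (lift ord0 i) (w j) = c.
    by case: wi => wi; [exists c0|exists cm] => j; have [] := Fc (w j); auto.
  rewrite /C; set A := (X in \det X).
  have /unlift_some[a0 j0a0 _] : j0 != ord0 by rewrite eq_sym neq_lift.
  have /unlift_some[a1 j0a1 _] : j0 != lift ord0 i.
    by rewrite (inj_eq lift_inj) eq_sym.
  have a01 : a0 != a1.
    by rewrite -(inj_eq (@lift_inj _ j0)) -j0a0 -j0a1 neq_lift.
  suff -> : \det A = 0 by rewrite mulr0.
  pose A' := \matrix_(a, j) (if a == a1 then 1 else A a j).
  have A'0 : \det A' = 0.
    apply: (determinant_alternate a01) => j.
    by rewrite !mxE eqxx (negPf a01) -j0a0 F0.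
  rewrite (@determinant_multilinear _ _ A A' A' a1 c 0) ?A'0 ?mulr0 ?addr0 //.
    by apply/rowP => j; rewrite !mxE eqxx -j0a1 wc mulr1 mul0r addr0.
    by apply/matrixP => a j; rewrite !mxE eq_sym (negPf (neq_lift _ _)).
  by apply/matrixP => a j; rewrite !mxE eq_sym (negPf (neq_lift _ _)).
rewrite /degree_sum.
transitivity (- \sum_(k < n.+2) (-1) ^+ (j0 + k) *
    \sum_(v : {ffun 'I_n.+1 -> 'I_m}) \sum_s (-1) ^+ odd_perm s *
      C [ffun j => chain_vertex v s (lift k j)]).
  under eq_bigr do under eq_bigr do rewrite E mulrN mulr_sumr.
  under eq_bigr do rewrite sumrN exchange_big.
  rewrite sumrN exchange_big; congr (- _); apply: eq_bigr => k _ /=.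
  rewrite mulr_sumr; apply: eq_bigr => v _; rewrite mulr_sumr.
  by apply: eq_bigr => s _; rewrite mulrCA.
pose G (k : 'I_n.+2) := \sum_(v : {ffun 'I_n.+1 -> 'I_m}) \sum_s
  (-1) ^+ odd_perm s * C [ffun j => chain_vertex v s (lift k j)].
have G_inner k : k != ord0 -> k != ord_max -> G k = 0.
  by move=> k0 kn; rewrite /G big1 // => v _; exact: chain_interior_face.
have G_outer : G ord0 = (-1) ^+ n * G ord_max by exact: chain_end_faces.
rewrite -/(\sum_(k < n.+2) (-1) ^+ (j0 + k) * G k) (bigD1 ord0) //=.
rewrite (bigD1 ord_max) //= big1 => [|k /andP[k0 kn]]; last by rewrite G_inner ?mulr0.
rewrite addr0 G_outer addn0 !exprD exprS mulrA mulN1r mulrN mulNr addrN oppr0 //.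
Qed.
End Kuhn.

Definition with_one n (L : 'I_n -> {ffun 'I_n -> nat} -> int)
    (j : 'I_n.+1) (w : {ffun 'I_n -> nat}) : int :=
  if unlift ord0 j is Some i then L i w else 1.

(** The matrix is the product of a unitriangular matrix adding the base [v], the permutation matrix
    of [s] and a triangular matrix of ones. *)
Lemma det_chain_mx_coord n m (v : {ffun 'I_n -> 'I_m}) (s : 'S_n) :
  \det (chain_mx (with_one (fun (i : 'I_n) w => (w i)%:Z)) v s) =
  (-1) ^+ odd_perm s.
Proof.
pose T : 'M[int]_(1 + n) := \matrix_(j, k) (j <= k)%N%:R.
pose Tl : 'M[int]_(n, 1 + n) := \matrix_(i, k) (i < k)%N%:R.
have TE : T = col_mx (const_mx 1) Tl.
  apply/matrixP => j k; rewrite !mxE.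
  case: splitP => [u|i] -> /=; rewrite mxE //.
  by rewrite [u]ord1.
have -> : chain_mx (with_one (fun (i : 'I_n) w => (w i)%:Z)) v s =
  block_mx 1%:M 0 (\col_i (v i)%:Z) 1%:M *m (block_mx 1%:M 0 0 (perm_mx s) *m T).
  rewrite TE !mul_block_col !mul0mx !mul1mx !addr0 !add0r -row_permE.
  apply/matrixP => j k; rewrite !mxE /with_one.
  case: splitP => [u|i] ej; case: unliftP => [i'|] ej'.
  - by move: ej; rewrite ej' [u]ord1.
  - by rewrite mxE.
  - have -> : i' = i.
      by apply/val_inj; move: ej; rewrite ej' /= /bump /= !add1n => -[].
    by rewrite !mxE big_ord1 !mxE mulr1 ffunE PoszD; case: ltnP.
  - by move: ej; rewrite ej'.
set B1 := block_mx _ _ _ 1%:M; set B2 := block_mx _ _ _ (perm_mx s).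
have dB1 : \det B1 = 1 by rewrite det_lblock !det1 mul1r.
have dB2 : \det B2 = (-1) ^+ odd_perm s by rewrite det_lblock det1 mul1r det_perm.
have dT : \det T = 1.
  rewrite -det_tr det_trig; last by apply/is_trig_mxP => a b ab; rewrite !mxE leqNgt ab.
  by rewrite big1 // => a _; rewrite !mxE leqnn.
by rewrite [LHS](det_mulmx B1) (det_mulmx B2) dB1 dB2 dT mul1r mulr1.
Qed.

Lemma degree_sum_coord n m :
  (0 < m)%N -> degree_sum m (with_one (fun (i : 'I_n) w => (w i)%:Z)) != 0.
Proof.
move=> m_gt0.
have -> : degree_sum m (with_one (fun (i : 'I_n) w => (w i)%:Z)) =
    \sum_(v : {ffun 'I_n -> 'I_m}) \sum_(s : 'S_n) 1.
  apply: eq_bigr => v _; apply: eq_bigr => s _.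
  by rewrite det_chain_mx_coord -expr2 sqrr_sign.
rewrite !sumr_const -mulrnA pnatr_eq0 muln_eq0 negb_or -!lt0n.
rewrite card_ffun !card_ord expn_gt0 m_gt0 /= andbT.
by apply/card_gt0P; exists 1%g.
Qed.

(** Since [L i] agrees with the [i]-th coordinate on the two facets of direction [i], [L] has the
    same nonzero degree as the coordinates. Some determinant is therefore nonzero, and its columns
    are distinct. *)
Theorem cube_sperner n m (L : 'I_n -> {ffun 'I_n -> nat} -> int) :
  (0 < m)%N ->
  (forall i (w : {ffun 'I_n -> nat}), w i = 0%N -> L i w = 0) ->
  (forall i (w : {ffun 'I_n -> nat}), w i = m -> L i w = m) ->
  exists (v : {ffun 'I_n -> 'I_m}) (s : 'S_n), forall k k' : 'I_n.+1,
    (forall i, L i (chain_vertex v s k) = L i (chain_vertex v s k')) -> k = k'.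
Proof.
move=> m_gt0 L0 Lm.
have {}Lne : degree_sum m (with_one L) != 0.
  (* The [L i] are replaced by coordinates one index at a time. By multilinearity each exchange
     changes the degree by that of [H], whose row [i0] vanishes on the two facets of direction
     [i0]. *)
  pose Lt t (i : 'I_n) (w : {ffun 'I_n -> nat}) : int :=
    if (i < t)%N then (w i)%:Z else L i w.
  have Lt0 t i (w : {ffun 'I_n -> nat}) : w i = 0%N -> Lt t i w = 0.
    by rewrite /Lt; case: ifP => _ wi; rewrite ?wi ?L0.
  have Ltm t i (w : {ffun 'I_n -> nat}) : w i = m -> Lt t i w = m.
    by rewrite /Lt; case: ifP => _ wi; rewrite ?wi ?Lm.
  have Lt_step t : (t < n)%N ->
      degree_sum m (with_one (Lt t.+1)) = degree_sum m (with_one (Lt t)).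
    move=> tn; pose i0 := Ordinal tn.
    have lt_t (i : 'I_n) : i != i0 -> (i < t.+1)%N = (i < t)%N.
      by rewrite -(inj_eq val_inj) ltnS leq_eqVlt => /negPf ->.
    pose H (i : 'I_n) (w : {ffun 'I_n -> nat}) : int :=
      if i == i0 then (w i)%:Z - L i w else Lt t i w.
    have H0 : degree_sum m (with_one H) = 0.
      apply: (degree_sum_eq0 (i0 := i0)) => [w|w wi|i ii0].
      - by rewrite /with_one unlift_none.
      - rewrite /with_one liftK /H eqxx.
        by case: wi => wi; [rewrite wi L0|rewrite wi Lm] => //; rewrite subrr.
      - exists 0, m%:Z => w; rewrite /with_one liftK /H (negPf ii0).
        by split => wi; [rewrite Lt0|rewrite Ltm].
    rewrite -[RHS]add0r -[X in X + _]H0 /degree_sum -big_split.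
    apply: eq_bigr => v _; rewrite -big_split; apply: eq_bigr => s _ /=.
    rewrite -mulrDr; congr (_ * _).
    rewrite (@determinant_multilinear _ _ _ (chain_mx (with_one H) v s)
      (chain_mx (with_one (Lt t)) v s) (lift ord0 i0) 1 1) ?mul1r //.
    - apply/rowP => k; rewrite !mxE !mul1r /with_one liftK /H eqxx /Lt /=.
      by rewrite ltnS leqnn ltnn subrK.
    - apply/matrixP => j k; rewrite !mxE /with_one.
      case: unliftP => // i ji; rewrite /H /Lt.
      have ii0 : i != i0.
        by apply: contra_eq_neq ji => ->; rewrite eq_sym neq_lift.
      by rewrite (negPf ii0) lt_t.
    - apply/matrixP => j k; rewrite !mxE /with_one.
      case: unliftP => // i ji; rewrite /Lt.
      have ii0 : i != i0.
        by apply: contra_eq_neq ji => ->; rewrite eq_sym neq_lift.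
      by rewrite lt_t.
  have Lt_all t : (t <= n)%N ->
      degree_sum m (with_one (Lt t)) = degree_sum m (with_one L).
    elim: t => [_|t IH tn]; last by rewrite Lt_step // IH // ltnW.
    by apply: eq_bigr => v _; apply: eq_bigr => s _; congr (_ * \det _).
  rewrite -(Lt_all n) //.
  suff -> : degree_sum m (with_one (Lt n)) =
      degree_sum m (with_one (fun (i : 'I_n) w => (w i)%:Z)).
    exact: degree_sum_coord.
  apply: eq_bigr => v _; apply: eq_bigr => s _; congr (_ * \det _).
  by apply/matrixP => j k; rewrite !mxE /with_one /Lt; case: unliftP => // i _; rewrite ltn_ord.
apply/not_existsP => nochain; move/eqP: Lne; apply.
rewrite /degree_sum big1 // => v _; rewrite big1 // => s _.
have [k [k' [kk' Lkk']]] : exists k k' : 'I_n.+1, k != k' /\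
    (forall i, L i (chain_vertex v s k) = L i (chain_vertex v s k')).
  apply/not_existsP => nok; apply: (nochain v); exists s => k k' Lk.
  apply/eqP/negPn/negP => kk'; apply: (nok k); exists k'; split => //.
rewrite -det_tr (determinant_alternate kk') ?mulr0 // => j; rewrite !mxE /with_one.
by case: unliftP.
Qed.

(** * Upper bounds for the width dimension *)

Section BigMinMaxContinuous.
Context {R : realType} {X : topologicalType} {I : Type}.
Implicit Types (r : seq I) (P : pred I) (F : I -> X -> R) (c : R).

Lemma continuous_maxr (f g : X -> R) :
  continuous f -> continuous g -> continuous (fun x => Num.max (f x) (g x)).
Proof. by move=> fc gc x; apply: (@continuous_max _ _ f g); [exact: fc|exact: gc]. Qed.

Lemma continuous_minr (f g : X -> R) :
  continuous f -> continuous g -> continuous (fun x => Num.min (f x) (g x)).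
Proof. by move=> fc gc x; apply: (@continuous_min _ _ f g); [exact: fc|exact: gc]. Qed.

Lemma continuous_mulr (f g : X -> R) :
  continuous f -> continuous g -> continuous (fun x => f x * g x).
Proof. by move=> fc gc x; apply: cvgM; [exact: fc|exact: gc]. Qed.

Lemma continuous_bigmin r P F c : (forall i, continuous (F i)) ->
  continuous (fun x => \big[Num.min/c]_(i <- r | P i) F i x).
Proof.
move=> Fc; elim: r => [|i r IH] x.
  by under eq_fun do rewrite big_nil; exact: cvg_cst.
under eq_fun do rewrite big_cons; case: (P i); last exact: IH.
by apply: continuous_min; [exact: Fc|exact: IH].
Qed.

Lemma continuous_bigmax r P F c : (forall i, continuous (F i)) ->
  continuous (fun x => \big[Num.max/c]_(i <- r | P i) F i x).
Proof.
move=> Fc; elim: r => [|i r IH] x.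
  by under eq_fun do rewrite big_nil; exact: cvg_cst.
under eq_fun do rewrite big_cons; case: (P i); last exact: IH.
by apply: continuous_max; [exact: Fc|exact: IH].
Qed.

Lemma continuous_bigsum r P F : (forall i, continuous (F i)) ->
  continuous (fun x => \sum_(i <- r | P i) F i x).
Proof.
move=> Fc; elim: r => [|i r IH] x.
  by under eq_fun do rewrite big_nil; exact: cvg_cst.
under eq_fun do rewrite big_cons; case: (P i); last exact: IH.
by apply: cvgD; [exact: Fc|exact: IH].
Qed.
End BigMinMaxContinuous.

Section CoverWeight.
Context {R : realType} {J : finType}.
Implicit Types (a : J -> R) (v : {set J}).

(* The vertices [v] with positive weight are the superlevel sets of [a]: these
   are the barycentric coordinates of [a] in the Kuhn triangulation of the
   cube. *)
Definition cover_weight a v : R :=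
  Num.max 0 (\big[Num.min/1]_(j in v) a j - \big[Num.max/0]_(j in ~: v) a j).

Lemma cover_weight_ge0 a v : 0 <= cover_weight a v.
Proof. by rewrite le_max lexx. Qed.

Lemma cover_weight_gt0 a v :
  (0 < cover_weight a v) =
  (\big[Num.max/0]_(j in ~: v) a j < \big[Num.min/1]_(j in v) a j).
Proof. by rewrite lt_max ltxx subr_gt0. Qed.

Lemma cover_weight_gt0_in a v j : 0 < cover_weight a v -> j \in v -> 0 < a j.
Proof.
rewrite cover_weight_gt0 => av jv.
apply: (@le_lt_trans _ _ (\big[Num.max/0]_(j in ~: v) a j)).
  exact: bigmax_ge_id.
exact: lt_le_trans av (bigmin_le_cond _ _ jv).
Qed.

Lemma cover_weight_gt0_notin a v j :
  0 < cover_weight a v -> j \notin v -> a j < 1.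
Proof.
rewrite cover_weight_gt0 => av jv.
apply: (@lt_le_trans _ _ (\big[Num.min/1]_(j in v) a j)); last exact: bigmin_le_id.
by apply: le_lt_trans av; apply: le_bigmax_cond; rewrite inE.
Qed.

Lemma cover_weight_ex a : (forall j, 0 <= a j <= 1) -> exists v, 0 < cover_weight a v.
Proof.
move=> a01; exists [set j | a j == 1]%SET; rewrite cover_weight_gt0.
apply: (@lt_le_trans _ _ 1).
  apply: bigmax_lt => // j; rewrite !inE => aj.
  by rewrite lt_neqAle aj; case/andP: (a01 j).
by apply: le_bigmin => // j; rewrite inE => /eqP ->.
Qed.

(** A set [v] of positive weight is the superlevel set of [a] above the maximum [M v] outside [v].
    So [M v] determines [v], and it is 0 or one of the interior values. *)
Lemma card_cover_weight a (s : seq R) :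
  (forall j, 0 <= a j <= 1) -> (forall j, 0 < a j < 1 -> a j \in s) ->
  (#|[set v | (0 < cover_weight a v)%R]%SET| <= (size s).+1)%N.
Proof.
move=> a01 as_; set V := [set v | _]%SET.
pose M v : R := \big[Num.max/0]_(j in ~: v) a j.
have Minj : {in V &, injective M}.
  suff MK v : v \in V -> v = [set j | M v < a j]%SET.
    by move=> v w vV wV Mvw; rewrite (MK v) // (MK w) // Mvw.
  rewrite inE cover_weight_gt0 => av; apply/setP => j; rewrite inE.
  apply/idP/idP => [jv|]; first exact: lt_le_trans av (bigmin_le_cond _ _ jv).
  by apply: contraTT => jv; rewrite -leNgt; apply: le_bigmax_cond; rewrite inE.
rewrite cardE -(size_map M) -[(size s).+1]/(size (0 :: s)); apply: uniq_leq_size.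
  rewrite map_inj_in_uniq ?enum_uniq // => v w; rewrite !mem_enum; exact: Minj.
move=> b /mapP[v]; rewrite mem_enum => vV ->{b}; rewrite inE.
have [//|M0] := eqVneq (M v) 0.
have M_ge0 : 0 <= M v by exact: bigmax_ge_id.
case: (pickP (mem (~: v)%SET)) => [j0 j0v|v0]; last first.
  by rewrite /M big_pred0 ?eqxx // in M0.
have [j jv Mj] := @eq_bigmax _ _ _ 0 j0 (mem (~: v)%SET) a j0v
  (fun j _ => proj1 (andP (a01 j))).
rewrite {1}/M Mj as_ //; rewrite /M Mj in M0 M_ge0.
rewrite lt_neqAle eq_sym M0 M_ge0 /=.
by apply: (@cover_weight_gt0_notin a v); [rewrite inE in vV|rewrite !inE in jv].
Qed.

Lemma continuous_cover_weight (X : topologicalType) (u : J -> X -> R) v :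
  (forall j, continuous (u j)) -> continuous (fun x => cover_weight (u^~ x) v).
Proof.
move=> uc.
have uvc : continuous (fun x => \big[Num.min/1]_(j in v) u j x -
    \big[Num.max/0]_(j in ~: v) u j x : R).
  by move=> x; apply: cvgB; [exact: continuous_bigmin|exact: continuous_bigmax].
apply: continuous_maxr uvc; exact: cst_continuous.
Qed.
End CoverWeight.

Lemma continuous_rV {R : realType} {X : topologicalType} {n : nat} (f : X -> 'rV[R]_n) :
  (forall i, continuous (fun x => f x ord0 i)) -> continuous f.
Proof.
move=> fc x A [P fP PA]; apply: (@filterS _ (nbhs x) _ [set y | forall i, P ord0 i (f y ord0 i)]).
  by move=> y Py; apply: PA => i j; rewrite (ord1 i); exact: Py.
by apply: filter_forall => i; apply: fc; exact: fP.
Qed.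

Section WidimUpper.
Context {R : realType}.

Definition skeleton_simplices k n : {set {set 'I_k}} :=
  [set s : {set 'I_k} | (s != finset.set0) && (#|s| <= n.+1)%N]%SET.

Lemma skeleton_neq0 k n : finset.set0 \notin skeleton_simplices k n.
Proof. by rewrite inE eqxx. Qed.

Lemma skeleton_sub k n (s t : {set 'I_k}) : s \in skeleton_simplices k n ->
  t \subset s -> t != finset.set0 -> t \in skeleton_simplices k n.
Proof.
rewrite !inE => /andP[_ sn] ts -> /=.
exact: leq_trans (subset_leq_card ts) sn.
Qed.

Definition skeleton k n := SimplicialComplex (skeleton_neq0 k n) (@skeleton_sub k n).

Lemma skeleton_dimension k n : (n < k)%N -> has_dimension (skeleton k n) n.
Proof.
move=> nk; apply/eqP; rewrite eqn_leq; apply/andP; split.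
  by apply/bigmax_leqP => s; rewrite inE => /andP[].
pose s := [set widen_ord nk i | i : 'I_n.+1]%SET.
have cs : #|s| = n.+1.
  rewrite card_imset ?card_ord // => i j /(congr1 val) /= ij; exact: val_inj.
rewrite -{1}cs; apply: leq_bigmax_cond; rewrite inE cs leqnn andbT.
by rewrite -card_gt0 cs.
Qed.

(** The normalised weights map [A] into an [n]-skeleton whose vertices are subsets of [J]. Points
    with the same image share a set of positive weight, and then no [u j] is 0 at one and 1 at the
    other. *)
Lemma widim_le (X : topologicalType) (d : X -> X -> R) (e e' : R) (A : set X)
    (J : finType) (u : J -> X -> R) (n : nat) :
  e' < e -> (forall j, continuous (u j)) -> (forall j x, 0 <= u j x <= 1) ->
  (forall x, A x -> exists2 s : seq R, (size s <= n)%N &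
     forall j, 0 < u j x < 1 -> u j x \in s) ->
  (forall x y, A x -> A y -> (forall j, ~ (u j x = 0 /\ u j y = 1)) ->
     (forall j, ~ (u j x = 1 /\ u j y = 0)) -> d x y <= e') ->
  (widim d e A <= n%:R%:E)%E.
Proof.
move=> e'e uc u01 un usep.
(* The [n.+1] spare vertices carry no weight; they make the dimension of the skeleton exactly
   [n]. *)
pose V := {set J}; pose k := (#|{: V}| + n.+1)%N.
pose w (x : X) (i : 'I_k) : R :=
  if fintype.split i is inl i1 then cover_weight (u^~ x) (enum_val i1) else 0.
have wc i : continuous (w^~ i).
  move=> x; rewrite /w; case: (fintype.split i) => i1; last exact: cvg_cst.
  exact: continuous_cover_weight.
have w_ge0 x i : 0 <= w x i by rewrite /w; case: (fintype.split i) => // ?; exact: cover_weight_ge0.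
have wl x v : w x (lshift n.+1 (enum_rank v)) = cover_weight (u^~ x) v.
  by rewrite /w (unsplitK (inl (enum_rank v))) enum_rankK.
have wS x : 0 < \sum_i w x i.
  have [v xv] := cover_weight_ex (u01^~ x).
  rewrite (bigD1 (lshift n.+1 (enum_rank v))) //=; apply: ltr_wpDr.
    by apply: sumr_ge0.
  by rewrite wl.
pose f x : 'rV[R]_k := \row_i (w x i / \sum_j w x j).
have f0 x i : (f x ord0 i != 0) = (0 < w x i).
  by rewrite mxE mulf_eq0 invr_eq0 negb_or (gt_eqF (wS x)) andbT lt_neqAle eq_sym w_ge0 andbT.
apply: ereal_inf_lbound; exists n => //; exists k, (skeleton k n); split.
  by apply: skeleton_dimension; rewrite /k leq_addl.
exists f; split.
- apply: continuous_subspaceT; apply: continuous_rV => i x.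
  under eq_fun do rewrite mxE.
  apply: cvgM; first exact: wc.
  by apply: cvgV; [rewrite gt_eqF|exact: continuous_bigsum].
- move=> _ [x Ax <-]; split.
  + by move=> i; rewrite mxE divr_ge0 ?sumr_ge0.
  + by under eq_bigr do rewrite mxE; rewrite -mulr_suml divff // gt_eqF.
  + rewrite inE; apply/andP; split.
      have [v xv] := cover_weight_ex (u01^~ x).
      apply/set0Pn; exists (lshift n.+1 (enum_rank v)).
      by rewrite inE f0 wl.
    have [s sn us] := un x Ax.
    apply: leq_trans (_ : (size s).+1 <= n.+1)%N; last by rewrite ltnS.
    apply: leq_trans (card_cover_weight (u01^~ x) us).
    rewrite -[X in (_ <= X)%N](card_imset _ (inj_comp (@lshift_inj #|{: V}| n.+1) enum_rank_inj)).
    apply: subset_leq_card; apply/fintype.subsetP => i; rewrite inE f0 /w.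
    case: splitP => // i1 ii1; last by rewrite ltxx.
    move=> xi; apply/imsetP; exists (enum_val i1); first by rewrite inE.
    by rewrite /= enum_valK; apply: val_inj.
- move=> z _; apply: (@le_lt_trans _ _ e'%:E); last by rewrite lte_fin.
  apply: ub_ereal_sup => _ [[x y] [/= [Ax fx] [Ay fy]] <-]; rewrite lee_fin.
  have [v xv] := cover_weight_ex (u01^~ x).
  have yv : 0 < cover_weight (u^~ y) v.
    have : 0 < w x (lshift n.+1 (enum_rank v)) by rewrite wl.
    by rewrite -f0 fx -fy f0 wl.
  apply: usep => // j [].
    move=> xj yj; have [jv|jv] := boolP (j \in v).
      by have := cover_weight_gt0_in xv jv; rewrite xj ltxx.
    by have := cover_weight_gt0_notin yv jv; rewrite yj ltxx.
  move=> xj yj; have [jv|jv] := boolP (j \in v).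
    by have := cover_weight_gt0_in yv jv; rewrite yj ltxx.
  by have := cover_weight_gt0_notin xv jv; rewrite xj ltxx.
Qed.
End WidimUpper.

(** * Clamped functions and compactness *)

Section Clamp.
Context {R : realType}.
Implicit Types x y t : R.

Definition clamp t : R := Num.max 0 (Num.min 1 t).

Lemma clamp_ge0 t : 0 <= clamp t.
Proof. by rewrite /clamp le_max lexx. Qed.

Lemma clamp_le1 t : clamp t <= 1.
Proof. by rewrite /clamp ge_max ler01 ge_min lexx. Qed.

Lemma clamp_itv t : 0 <= clamp t <= 1.
Proof. by rewrite clamp_ge0 clamp_le1. Qed.

Lemma clamp_le0 t : t <= 0 -> clamp t = 0.
Proof. by move=> t0; rewrite /clamp max_l // ge_min t0 orbT. Qed.

Lemma clamp_ge1 t : 1 <= t -> clamp t = 1.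
Proof. by move=> t1; rewrite /clamp min_l // max_r. Qed.

Lemma clamp_interior t : 0 < clamp t < 1 -> 0 < t < 1.
Proof.
move=> /andP[]; have [t0|t0] := leP t 0; first by rewrite clamp_le0 // ltxx.
by have [t1|//] := leP 1 t; rewrite clamp_ge1 // ltxx.
Qed.

Lemma continuous_clamp (X : topologicalType) (f : X -> R) :
  continuous f -> continuous (fun z => clamp (f z)).
Proof.
move=> fc; apply: continuous_maxr; first exact: cst_continuous.
by apply: continuous_minr => //; exact: cst_continuous.
Qed.

Lemma continuous_piece (X : topologicalType) (f : X -> R) (a b : R) :
  continuous f -> continuous (fun z => clamp (a * f z - b)).
Proof.
move=> fc; apply: (@continuous_clamp _ (fun z => a * f z - b)) => z.
by apply: cvgB; [apply: cvgM; [exact: cvg_cst|exact: fc]|exact: cvg_cst].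
Qed.

(** At most one piece of a number is interior, so cutting into pieces does not increase the count of
    interior values. *)
Lemma piece_interior y (h : nat) : 0 < clamp (y - h%:R) < 1 -> h = Num.truncn y.
Proof.
move=> /clamp_interior /andP[hy yh]; apply/esym/truncn_def.
by rewrite -[h.+1]addn1 natrD; apply/andP; split; lra.
Qed.

Lemma pieces_interior (m h : nat) y : 0 <= y <= 1 -> (h < m)%N ->
  0 < clamp (m%:R * y - h%:R) < 1 -> 0 < y < 1.
Proof.
move=> /andP[] + + hm; rewrite !le_eqVlt.
move=> /orP[/eqP <-|-> /orP[/eqP ->|-> //]].
  by rewrite mulr0 sub0r clamp_le0 ?ltxx // oppr_le0 ler0n.
by rewrite mulr1 clamp_ge1 ?ltxx ?andbF // lerBrDr -[1]/(1%:R) -natrD ler_nat add1n.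
Qed.

(** Otherwise, with [t] the integer part of [m x], the unit interval starting at [t.+1] lies between
    [m x] and [m y], and its piece is 0 at [x] and 1 at [y]. *)
Lemma clamp_pieces_separate (m : nat) x y :
  0 <= x <= 1 -> 0 <= y <= 1 -> (0 < m)%N ->
  (forall h : 'I_m, ~ (clamp (m%:R * x - h%:R) = 0 /\ clamp (m%:R * y - h%:R) = 1)) ->
  y <= x + 2 / m%:R.
Proof.
move=> /andP[x0 x1] /andP[y0 y1] m0 xy; rewrite leNgt; apply/negP => lt_xy.
have m0' : 0 < m%:R :> R by rewrite ltr0n.
have {}lt_xy : m%:R * x + 2 < m%:R * y.
  by rewrite -(ltr_pM2l m0') mulrDr [m%:R * (_ / _)]mulrC divfK // ?gt_eqF in lt_xy.
set t := Num.truncn (m%:R * x).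
have tx : t%:R <= m%:R * x by rewrite truncn_le mulr_ge0 // ler0n.
have xt : m%:R * x < t.+1%:R by exact: truncnS_gt.
have my : m%:R * y <= m%:R by rewrite ler_piMr // ltW.
have tm : (t.+1 < m)%N.
  rewrite -(ltr_nat R) -[t.+1]addn1 natrD; lra.
apply: (xy (Ordinal tm)); split => /=.
  by apply: clamp_le0; lra.
by apply: clamp_ge1; rewrite -[t.+1]addn1 natrD; lra.
Qed.
End Clamp.

Section CompactUniform.
Context {R : realType}.

(** Otherwise counterexamples [z_ n] would cluster at a common zero of the [D i], near which [O]
    holds. The countable family [D] plays the role of a metric. *)
Lemma compact_uniform_nbhs (Z : topologicalType) (D : nat -> Z -> R) (O : set Z) :
  compact [set: Z] -> (forall i, continuous (D i)) ->
  (forall z, (forall i, D i z = 0) -> nbhs z O) ->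
  exists n, forall z, (forall i, (i <= n)%N -> `|D i z| < n.+1%:R^-1) -> O z.
Proof.
move=> Zc Dc DO; apply: contrapT => /forallNP nex.
have {}nex n : exists z, (forall i, (i <= n)%N -> `|D i z| < n.+1%:R^-1) /\ ~ O z.
  by have /existsNP[z /not_implyP[zD zO]] := nex n; exists z.
have [z_ z_P] := choice nex.
have [] := Zc (z_ @ \oo) _; first exact: filterT.
move=> z [_ zcl].
have near_z (A : set Z) (B : set nat) : nbhs z A -> (\forall n \near \oo, B n) ->
    exists n, B n /\ A (z_ n).
  move=> zA oB; have [y [[n Bn <-] Ay]] : z_ @` B `&` A !=set0.
    by apply: zcl => //; apply: filterS oB => n Bn; exists n.
  by exists n.
have zO : nbhs z O.
  apply: DO => i; apply/eqP/negPn/negP => Diz.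
  have Diz0 : 0 < `|D i z| / 2 by rewrite divr_gt0 // normr_gt0.
  have H : \forall n \near \oo, (i <= n)%N /\ n.+1%:R^-1 < `|D i z| / 2.
    near=> n; split; first by near: n; exact: nbhs_infty_ge.
    by near: n; exact: near_infty_natSinv_lt (PosNum Diz0).
  have [n [[in_ nD] zn]] := near_z _ _
    (@cvgr_dist_lt _ _ _ _ _ (D i) _ (Dc i z) _ Diz0) H.
  have Dzn : `|D i z - D i (z_ n)| < `|D i z| / 2 := zn.
  have Dzn' : `|D i (z_ n)| < `|D i z| / 2 by exact: lt_trans ((z_P n).1 i in_) nD.
  have := ler_normD (D i z - D i (z_ n)) (D i (z_ n)).
  by rewrite subrK leNgt [X in _ < X](splitr `|D i z|) ltrD.
have [n [_ zn]] := near_z _ setT zO filterT.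
exact: (z_P n).2.
Unshelve. all: by end_near.
Qed.

Lemma compact_uniform (Z : topologicalType) (D : nat -> Z -> R) (g : Z -> R) (e : R) :
  compact [set: Z] -> (forall i, continuous (D i)) -> continuous g ->
  (forall z, (forall i, D i z = 0) -> g z < e) ->
  exists n, forall z, (forall i, (i <= n)%N -> `|D i z| < n.+1%:R^-1) -> g z < e.
Proof.
move=> Zc Dc gc De; apply: (compact_uniform_nbhs (O := [set z | g z < e])) => // z zD.
exact: (@cvgr_lt _ _ _ _ g _ (gc z) _ (De z zD)).
Qed.

Lemma compatible_metric_continuous (X : topologicalType) (d : X -> X -> R) :
  compatible_metric d -> continuous (fun p : X * X => d p.1 p.2).
Proof.
move=> [[d_ge0 d0 dsym dtri] dnbhs] [x y]; apply/cvgrPdist_lt => e e0 /=.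
have e2 : 0 < e / 2 by rewrite divr_gt0.
have ball_nbhs z : nbhs z [set w | d z w < e / 2] by apply/dnbhs; exists (e / 2).
exists ([set w | d x w < e / 2], [set w | d y w < e / 2]) => //=.
move=> [x' y'] [/= xx' yy'].
have := dtri x x' y; have := dtri x' y' y; have := dtri x' x y'; have := dtri x y y'.
rewrite (dsym x' x) (dsym y' y) ltr_norml => *; lra.
Qed.

Lemma orbit_metric_continuous (X : topologicalType) (T : X -> X) (d : X -> X -> R) N :
  continuous T -> compatible_metric d ->
  continuous (fun p : X * X => orbit_metric T d N p.1 p.2).
Proof.
move=> Tc dc; apply: continuous_bigmax => i.
have Tic : continuous (iter i T).
  elim: (nat_of_ord i) => [|j IH] x /=; first exact: cvg_id.
  by apply: continuous_comp; [exact: IH|exact: Tc].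
move=> p; apply: (@continuous_comp _ _ _ (fun p : X * X => (iter i T p.1, iter i T p.2))
  (fun q : X * X => d q.1 q.2)); last exact: compatible_metric_continuous.
apply: cvg_pair => /=.
  by apply: (@continuous_comp _ _ _ fst (iter i T)); [exact: cvg_fst|exact: Tic].
by apply: (@continuous_comp _ _ _ snd (iter i T)); [exact: cvg_snd|exact: Tic].
Qed.
End CompactUniform.

(** * Lower bounds for the width dimension *)

Section WidimLower.
Context {R : realType}.

Section PartialSums.
Variables (k n : nat) (K : simplicial_complex k).
Hypothesis dimK : has_dimension K n.

Definition partial_sum (y : 'rV[R]_k) (j : nat) : R := \sum_(l < k | (l < j)%N) y ord0 l.

Lemma partial_sumS y (l : 'I_k) : partial_sum y l.+1 = y ord0 l + partial_sum y l.
Proof.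
rewrite /partial_sum (bigD1 l) //=; congr (_ + _); apply: eq_bigl => i.
by rewrite ltnS [RHS]ltn_neqAle andbC -(inj_eq val_inj).
Qed.

Lemma partial_sum_itv y j : realization K y -> 0 <= partial_sum y j <= 1.
Proof.
move=> [y0 y1 _]; apply/andP; split; first by apply: sumr_ge0.
by rewrite -y1 [leRHS](bigID (fun l : 'I_k => (l < j)%N)) /= lerDl sumr_ge0.
Qed.

(* The smallest vertex of the carrier of [y] contributes the value 0, whence
   at most [n] values in the open interval. *)
Lemma partial_sum_interior y : realization K y ->
  exists2 s : seq R, (size s <= n)%N &
    forall j, 0 < partial_sum y j < 1 -> partial_sum y j \in s.
Proof.
move=> [y0 y1 yK]; set S := finset _ in yK.
pose S' := [set l in S | 0 < partial_sum y l]%SET.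
exists [seq partial_sum y (l : 'I_k) | l <- enum S'].
  rewrite size_map -cardE -ltnS; apply: (@leq_trans #|S|); last first.
    by rewrite -dimK; apply: (@leq_bigmax_cond _ _ (fun s : {set 'I_k} => #|s|)).
  apply: proper_card; apply/properP; split.
    by apply/fintype.subsetP => l; rewrite inE => /andP[].
  have /set0Pn[l0 l0S] : S != finset.set0.
    by apply: contraTneq yK => ->; exact: simplices_neq0.
  have [l lS lmin] := @arg_minnP _ l0 (mem S) val l0S.
  exists l => //; rewrite inE negb_and -leNgt; apply/orP; right.
  rewrite /partial_sum big1 // => i il; apply/eqP/negPn/negP => yi.
  have /lmin : i \in S by rewrite inE.
  by rewrite /= leqNgt il.
move=> j /andP[j0 j1].
have [l0 jl0 l0S] : exists2 l : 'I_k, (j <= l)%N & l \in S.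
  apply: contrapT => nol; move: j1; rewrite -y1 /partial_sum big_mkcond /=.
  rewrite (eq_bigr (fun l => y ord0 l)) ?ltxx // => l _; case: ltnP => // jl.
  by apply/eqP; rewrite eq_sym; apply/negPn/negP => yl; apply: nol; exists l; rewrite ?inE.
(* Raising [j] to the next vertex of the carrier does not change the partial sum. *)
have [l /andP[/= jl lS] lmin] :=
  @arg_minnP _ l0 (fun l : 'I_k => (j <= l)%N && (l \in S)) val (introT andP (conj jl0 l0S)).
have jlE : partial_sum y j = partial_sum y l.
  rewrite /partial_sum [LHS]big_mkcond [RHS]big_mkcond; apply: eq_bigr => i _.
  case: ltnP => [ij|ji]; first by rewrite (leq_trans ij jl).
  case: ltnP => // il; apply/eqP; rewrite eq_sym; apply/negPn/negP => yi.
  by have := lmin i; rewrite ji inE yi /= leqNgt il => /(_ isT).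
by rewrite jlE; apply/mapP; exists l; rewrite // mem_enum inE lS -jlE j0.
Qed.
End PartialSums.

(** An [e]-embedding into dimension [n] yields weights [W v], at most [n.+1] of them positive at
    each point, with [d] below [e] on each support, so that no support meets both [F0 i] and [F1 i].
    Labelling a fine grid by weights bounded away from 0, [cube_sperner] finds [N.+1] labels whose
    weights are all positive at one point. *)
Lemma widim_ge (X : topologicalType) (c : nat -> X -> R) (d : X -> X -> R) (e : R)
    (N : nat) (F0 F1 : 'I_N -> set X) (grid : nat -> {ffun 'I_N -> nat} -> X) :
  compact [set: X] -> (forall i, continuous (c i)) ->
  (forall x y, (forall i, c i x = c i y) -> x = y) ->
  continuous (fun p : X * X => d p.1 p.2) ->
  (forall i x y, F0 i x -> F1 i y -> e <= d x y) ->
  (forall i m (w : {ffun 'I_N -> nat}), w i = 0%N -> F0 i (grid m.+1 w)) ->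
  (forall i m (w : {ffun 'I_N -> nat}), w i = m.+1 -> F1 i (grid m.+1 w)) ->
  (forall i m (w w' : {ffun 'I_N -> nat}), (forall j, w j <= w' j <= (w j).+1)%N ->
     `|c i (grid m.+1 w) - c i (grid m.+1 w')| <= m.+1%:R^-1) ->
  (N%:R%:E <= widim d e [set: X])%E.
Proof.
move=> Xc cc csep dc F01 gridF0 gridF1 grid_lip.
apply: le_ereal_inf_tmp => _ [n [k [K [dimK [f [fcont fK fe]]]]] <-].
rewrite lee_fin ler_nat leqNgt; apply/negP => nN.
have {}fcont : continuous f by apply/continuous_subspace_setT.
have {}fK x : realization K (f x) by apply: fK; exists x.
have {}fe x y : f x = f y -> d x y < e.
  move=> fxy; rewrite -lte_fin; apply: le_lt_trans (fe _ (fK x)).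
  by apply: ereal_sup_ubound; exists (x, y); split; split => //=.
pose P j x := partial_sum (f x) j.
have Pc j : continuous (P j).
  apply: continuous_bigsum => l x.
  by apply: (@continuous_comp _ _ _ f (fun y => y ord0 l)); [exact: fcont|exact: coord_continuous].
have XXc : compact [set: X * X] by rewrite -setXTT; exact: compact_setX.
(* As [f] identifies only points with [d] below [e], compactness gives the same for points whose
   first partial sums nearly agree. *)
have [n0 n0P] : exists n0, forall x y, (forall j, (j <= n0)%N -> `|P j x - P j y| < n0.+1%:R^-1) ->
    d x y < e.
  have [|//|p pP|n0 n0P] := @compact_uniform R (X * X)%type
    (fun j p => P j p.1 - P j p.2) (fun p => d p.1 p.2) e XXc.
  - move=> j p; apply: cvgB.
      by apply: (@continuous_comp _ _ _ fst (P j)); [exact: cvg_fst|exact: Pc].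
    by apply: (@continuous_comp _ _ _ snd (P j)); [exact: cvg_snd|exact: Pc].
  - apply: fe; apply/rowP => l.
    have := pP l.+1; rewrite /P !partial_sumS => /eqP.
    have /eqP := pP l; rewrite /P subr_eq0 => /eqP ->.
    by rewrite opprD addrACA subrr addr0 subr_eq0 => /eqP.
  by exists n0 => x y; exact: (n0P (x, y)).
pose M := (2 * n0.+1).+1.
have M0 : 0 < M%:R :> R by rewrite ltr0n.
have M2 : 2 / M%:R < n0.+1%:R^-1 :> R.
  by rewrite ltr_pdivrMr // mulrC ltr_pdivlMr ?ltr0n // -natrM ltr_nat.
pose J := ('I_n0.+1 * 'I_M)%type.
pose u (jh : J) x : R := clamp (M%:R * P jh.1 x - jh.2%:R).
have uc jh : continuous (u jh) by exact: continuous_piece.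
have u01 x jh : 0 <= u jh x <= 1 by exact: clamp_itv.
pose W v x := cover_weight (u^~ x) v.
have Wc v : continuous (W v) by exact: continuous_cover_weight.
have Wsmall v x y : 0 < W v x -> 0 < W v y -> d x y < e.
  move=> xv yv.
  have u_sep (x' y' : X) jh : 0 < W v x' -> 0 < W v y' -> ~ (u jh x' = 0 /\ u jh y' = 1).
    move=> x'v y'v [ux uy]; have [jv|jv] := boolP (jh \in v).
      by have := cover_weight_gt0_in x'v jv; rewrite ux ltxx.
    by have := cover_weight_gt0_notin y'v jv; rewrite uy ltxx.
  apply: n0P => j jn; apply: le_lt_trans M2.
  have Pitv z : 0 <= P j z <= 1 by exact: partial_sum_itv (fK z).
  have Ple x' y' : 0 < W v x' -> 0 < W v y' -> P j y' <= P j x' + 2 / M%:R.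
    move=> x'v y'v; apply: clamp_pieces_separate => // h.
    exact: (u_sep x' y' (Ordinal (jn : (j < n0.+1)%N), h) x'v y'v).
  by rewrite ler_distlC lerBlDr !Ple.
have Wcard x : (#|[set v | (0 < W v x)%R]%SET| <= n.+1)%N.
  have [s sn sP] := partial_sum_interior dimK (fK x).
  apply: leq_trans (_ : (size s).+1 <= n.+1)%N; last by rewrite ltnS.
  rewrite -(size_map (fun y => clamp (M%:R * y - (Num.truncn (M%:R * y))%:R))).
  apply: card_cover_weight => // jh ujh; apply/mapP; exists (P jh.1 x).
    exact: sP (pieces_interior (partial_sum_itv _ (fK x)) (ltn_ord _) ujh).
  by rewrite /u -(piece_interior ujh).
pose Wmax x := \big[Num.max/0]_v W v x.
have [n1 n1P] : exists n1, forall x, exists v, n1.+1%:R^-1 <= W v x.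
  have [|||n1 n1P] := @compact_uniform R X (fun=> Wmax) (fun=> 1) 1 Xc.
  - by move=> _; exact: continuous_bigmax.
  - exact: cst_continuous.
  - move=> x /(_ 0%N) Wx0; have [v xv] := cover_weight_ex (u01 x).
    have : W v x <= Wmax x by apply: le_bigmax.
    by rewrite Wx0 leNgt xv.
  exists n1 => x; have : n1.+1%:R^-1 <= Wmax x.
    rewrite leNgt; apply/negP => Wx; have := n1P x; rewrite ltxx => /(_ _)/negP; apply => // i _.
    by rewrite ger0_norm // /Wmax bigmax_ge_id.
  move/bigmax_geP => [|[v _ vx]]; last by exists v.
  by rewrite leNgt invr_gt0 ltr0n.
set ka : R := n1.+1%:R^-1 in n1P.
have ka0 : 0 < ka by rewrite invr_gt0 ltr0n.
have [n2 n2P] : exists n2, forall x y, (forall i, `|c i x - c i y| < n2.+1%:R^-1) ->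
    forall v, `|W v x - W v y| < ka.
  have [|||n2 n2P] := @compact_uniform R (X * X)%type (fun i p => c i p.1 - c i p.2)
     (fun p => \big[Num.max/0]_v `|W v p.1 - W v p.2|) ka XXc.
  - move=> i p; apply: cvgB.
      by apply: (@continuous_comp _ _ _ fst (c i)); [exact: cvg_fst|exact: cc].
    by apply: (@continuous_comp _ _ _ snd (c i)); [exact: cvg_snd|exact: cc].
  - apply: continuous_bigmax => v p; apply: cvg_norm; apply: cvgB.
      by apply: (@continuous_comp _ _ _ fst (W v)); [exact: cvg_fst|exact: Wc].
    by apply: (@continuous_comp _ _ _ snd (W v)); [exact: cvg_snd|exact: Wc].
  - move=> [x y] /= xy; have -> : x = y.
      by apply: csep => i; apply/eqP; rewrite -subr_eq0 xy.
    by apply/bigmax_ltP; split => // v _; rewrite subrr normr0.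
  exists n2 => x y xy v; apply: le_lt_trans (n2P (x, y) _) => //.
  exact: (le_bigmax _ (fun v => `|W v x - W v y|)).
have [phi phiP] := choice (fun w => n1P (grid n2.+2 w)).
(* [L i w] records whether the support chosen at [w] meets [F0 i]. It depends on [w] only through
   [phi w], so vertices with distinct [L] have distinct [phi]. *)
pose L (i : 'I_N) (w : {ffun 'I_N -> nat}) : int :=
  if pselect (exists2 x, F0 i x & 0 < W (phi w) x) then 0 else n2.+2%:Z.
have [//|||v0 [s kinj]] := @cube_sperner N n2.+2 L.
- move=> i w wi; rewrite /L; case: pselect => // -[].
  by exists (grid n2.+2 w); [exact: gridF0|exact: lt_le_trans (phiP w)].
- move=> i w wi; rewrite /L; case: pselect => // -[x Fx xw].
  have : d x (grid n2.+2 w) < e by apply: (Wsmall (phi w)) => //; exact: lt_le_trans (phiP w).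
  by rewrite ltNge (F01 i) //; exact: gridF1.
pose ch (l : 'I_N.+1) := chain_vertex v0 s l.
have phi_inj : injective (fun l => phi (ch l)).
  by move=> l l' phill'; apply: kinj => i; rewrite /L -/(ch l) -/(ch l') phill'.
suff : (N.+1 <= n.+1)%N by rewrite ltnS leqNgt nN.
apply: leq_trans (Wcard (grid n2.+2 (ch ord0))).
rewrite -[X in (X <= _)%N]card_ord -(card_imset _ phi_inj).
apply: subset_leq_card; apply/fintype.subsetP => _ /imsetP[l _ ->]; rewrite inE.
(* The cube is cut into [n2.+2] parts per direction to make the mesh strictly less than
   [n2.+1%:R^-1]. *)
have chl : forall i, `|c i (grid n2.+2 (ch ord0)) - c i (grid n2.+2 (ch l))| < n2.+1%:R^-1.
  move=> i; apply: (@le_lt_trans _ _ (n2.+2%:R^-1)).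
    apply: grid_lip => j; rewrite !ffunE addn0 leq_addr /=.
    by rewrite -[leqRHS]addn1 leq_add2l; case: (_ < _)%N.
  by rewrite ltf_pV2 ?posrE ?ltr0n // ltr_nat.
have := n2P _ _ chl (phi (ch l)); have := phiP (ch l).
by rewrite ltr_distlC => h /andP[]; lra.
Qed.
End WidimLower.

(** * Subshifts *)

Section Topology.
Context {R : realType}.

Lemma continuous_ptws (Z : topologicalType) (J : eqType) (f : Z -> {ptws J -> R}) :
  (forall j, continuous (fun z => f z j)) -> continuous f.
Proof.
move=> fc z; apply/cvg_sup => j.
exact: (@continuous_comp_initial _ _ _ (fun g : {ptws J -> R} => g j) f (fc j)).
Qed.

Lemma continuous_proj (J : eqType) (j : J) :
  continuous (fun w : {ptws J -> R} => w j).
Proof. exact: (@proj_continuous J (fun=> R) j). Qed.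

Lemma compact_set_type (E : topologicalType) (A : set E) :
  compact A -> compact [set: set_type A].
Proof.
move=> Ac F FF _.
have [|e [Ae ecl]] := Ac (set_val @ F) _.
  by apply: (@filterS _ F _ setT) filterT => x _; exact: set_valP.
 exists (SigSub (mem_set Ae)); split => // U V FU.
case=> _ [[W oW <-] We WV].
have [||_ [[u Uu <-] Wu]] := ecl [set set_val u | u in U] W.
- by apply: (@filterS _ F _ U) FU => u Uu; exists u.
- by apply: open_nbhs_nbhs; split.
by exists u; split => //; exact: WV.
Qed.

(** The metric is the supremum of the [|c i x - c i y| / (i + 1)]. Balls are neighbourhoods because
    finitely many [i] matter at a given radius; neighbourhoods contain balls by compactness. *)
Lemma ex_compatible_metric (X : topologicalType) (c : nat -> X -> R) :
  compact [set: X] -> (forall i, continuous (c i)) ->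
  (forall i x, 0 <= c i x <= 1) ->
  (forall x y, (forall i, c i x = c i y) -> x = y) ->
  exists d : X -> X -> R, compatible_metric d.
Proof.
move=> Xc cc c01 csep.
pose D x y := range (fun i => `|c i x - c i y| / i.+1%:R).
pose d x y := sup (D x y).
have i1 (i : nat) : 0 < i.+1%:R :> R by rewrite ltr0n.
have cle i x y : `|c i x - c i y| / i.+1%:R <= i.+1%:R^-1.
  rewrite ler_piMl ?invr_ge0 ?ler0n // ler_norml.
  by have := c01 i x; have := c01 i y => /andP[? ?] /andP[? ?]; lra.
have Dub x y : has_ubound (D x y).
  exists 1 => _ [i _ <-]; apply: le_trans (cle i x y) _.
  by rewrite invf_le1 // ler1n.
have D0 x y : D x y !=set0 by exists (`|c 0%N x - c 0%N y| / 1%:R); exists 0%N.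
have d_ge i x y : `|c i x - c i y| / i.+1%:R <= d x y.
  by apply: ub_le_sup; [exact: Dub|exists i].
have d_le x y b : (forall i, `|c i x - c i y| / i.+1%:R <= b) -> d x y <= b.
  by move=> ib; apply: ge_sup => // _ [i _ <-].
have dge0 x y : 0 <= d x y by apply: le_trans (d_ge 0%N x y); rewrite divr_ge0.
exists d; split; first split => //.
- move=> x y; split=> [dxy|->]; last first.
    by apply/eqP; rewrite eq_le dge0 andbT d_le // => i; rewrite subrr normr0 mul0r.
  apply: csep => i; apply/eqP; rewrite -subr_eq0 -normr_le0.
  by have := d_ge i x y; rewrite dxy ler_pdivrMr // mul0r.
- by move=> x y; rewrite /d /D; under eq_fun do rewrite distrC.
- move=> x y z; apply: d_le => i; apply: le_trans (lerD (d_ge i x y) (d_ge i y z)).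
  by rewrite -mulrDl ler_pM2r ?invr_gt0 // ler_distD.
move=> x U; split=> [xU|[e e0 eU]].
  have [||n nU] := @compact_uniform_nbhs R X (fun i y => c i x - c i y) U Xc.
  - by move=> i y; apply: cvgB; [exact: cvg_cst|exact: cc].
  - by move=> y xy; suff -> : y = x by []; apply: csep => i; apply/esym/eqP; rewrite -subr_eq0 xy.
  exists (n.+1%:R^-1 * n.+1%:R^-1); first by rewrite mulr_gt0 ?invr_gt0.
  move=> y /= dxy; apply: nU => i in_.
  have := le_lt_trans (d_ge i x y) dxy.
  rewrite ltr_pdivrMr // => /lt_le_trans; apply.
  by rewrite -mulrA ler_piMr ?invr_ge0 ?ler0n // mulrC ler_pdivrMr // mul1r ler_nat.
have e2 : 0 < e / 2 by rewrite divr_gt0.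
have [n _ nP] := near_infty_natSinv_lt (PosNum e2).
have ne : n.+1%:R^-1 < e / 2 by apply: (nP n) => /=.
apply: (@filterS _ (nbhs x) _ [set y | forall i : 'I_n, `|c i x - c i y| < e / 2]); last first.
  apply: filter_forall => i.
  exact: (@cvgr_dist_lt _ _ _ _ _ (c i) _ (cc i x) _ e2).
move=> y xy; apply: eU => /=; apply: (@le_lt_trans _ _ (e / 2)); last by lra.
apply: d_le => i; have [i_n|n_i] := ltnP i n.
  rewrite ler_pdivrMr //; apply: le_trans (ltW (xy (Ordinal i_n))) _.
  by rewrite ler_peMr ?ler1n // ltW.
apply: le_trans (cle i x y) _; apply: le_trans (ltW ne).
by rewrite lef_pV2 ?posrE // ler_nat.
Qed.
End Topology.

Section Subshift.
Context {R : realType} {I : countType}.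

Definition shift (z : int) (w : {ptws int * I -> R}) : {ptws int * I -> R} :=
  fun p => w (p.1 + z, p.2).

Variable A : set {ptws int * I -> R}.
Hypothesis Ac : compact A.
Hypothesis A01 : forall w p, A w -> 0 <= w p <= 1.
Hypothesis Ash : forall z w, A w -> A (shift z w).

Definition shift_on (z : int) (x : set_type A) : set_type A :=
  SigSub (mem_set (Ash z (set_valP x))).

Definition coord (x : set_type A) (a : int) (i : I) : R := set_val x (a, i).

Lemma coord_shift_on z x a i : coord (shift_on z x) a i = coord x (a + z) i.
Proof. by []. Qed.

Lemma coord_iter_shift n x a i :
  coord (iter n (shift_on 1) x) a i = coord x (a + n%:Z) i.
Proof.
elim: n a => [|n IH] a; first by rewrite addr0.
by rewrite iterS coord_shift_on IH -addrA intS.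
Qed.

Lemma coord_itv x a i : 0 <= coord x a i <= 1.
Proof. exact: A01 (set_valP x). Qed.

Lemma coord_continuous_set a i : continuous (fun x => coord x a i).
Proof.
move=> x; apply: (@continuous_comp _ _ _ (@set_val _ A) (fun w => w (a, i))).
  exact: initial_continuous.
exact: continuous_proj.
Qed.

Lemma continuous_to_set (Z : topologicalType) (f : Z -> set_type A) :
  (forall a i, continuous (fun z => coord (f z) a i)) -> continuous f.
Proof.
move=> fc; apply: (@continuous_comp_initial _ _ _ (@set_val _ A) f).
by apply: continuous_ptws => -[a i]; exact: fc.
Qed.

Lemma coord_inj x y : (forall a i, coord x a i = coord y a i) -> x = y.
Proof. by move=> xy; apply: val_inj; apply/funext => -[a i]; exact: xy. Qed.

(** All coordinates as one sequence, the form used by the compactness lemmas; numbers that encode no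
    coordinate give the constant 0. *)
Definition enum_coord (j : nat) (x : set_type A) : R :=
  if unpickle j is Some (a, i) then coord x a i else 0.

Lemma enum_coord_continuous j : continuous (enum_coord j).
Proof.
rewrite /enum_coord; case: unpickle => [[a i]|]; last exact: cst_continuous.
exact: coord_continuous_set.
Qed.

Lemma enum_coord_inj x y : (forall j, enum_coord j x = enum_coord j y) -> x = y.
Proof.
move=> xy; apply: coord_inj => a i.
by have := xy (pickle (a, i)); rewrite /enum_coord pickleK.
Qed.

Lemma subshift_compact : compact [set: set_type A].
Proof. exact: compact_set_type. Qed.

Lemma shift_on_continuous z : continuous (shift_on z).
Proof.
by apply: continuous_to_set => a i; exact: (coord_continuous_set (a := a + z) (i := i)).
Qed.

Lemma subshift_dynamical_system : dynamical_system R (shift_on 1).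
Proof.
split; first exact: subshift_compact.
- apply: (ex_compatible_metric (c := enum_coord)) => [|j|j x|x y].
  + exact: subshift_compact.
  + exact: enum_coord_continuous.
  + rewrite /enum_coord; case: unpickle => [[a i]|]; last by rewrite lexx ler01.
    exact: coord_itv.
  + exact: enum_coord_inj.
- exists (shift_on (-1)); split; try exact: shift_on_continuous.
  + by move=> x; apply: coord_inj => a i; rewrite !coord_shift_on subrK.
  + by move=> x; apply: coord_inj => a i; rewrite !coord_shift_on addrK.
Qed.

Variable d : set_type A -> set_type A -> R.
Hypothesis dc : compatible_metric d.

(** By compactness finitely many coordinates near time 0 force [d] below [e]. Along an orbit segment
    only the window moves, so [M] and [s] do not depend on [L]. *)
Lemma subshift_window (e : R) : 0 < e ->
  exists (M : nat) (s : seq I), forall (L : nat) x y,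
    (forall (a : int) i, - M%:Z <= a < L%:Z + M%:Z -> i \in s ->
       `|coord x a i - coord y a i| < M.+1%:R^-1) ->
    orbit_metric (shift_on 1) d L x y < e.
Proof.
move=> e0; have [[_ d_eq0 _ _] _] := dc.
have [|||p pP|n nP] := @compact_uniform R (set_type A * set_type A)%type
   (fun j p => enum_coord j p.1 - enum_coord j p.2) (fun p => d p.1 p.2) e.
- by rewrite -setXTT; apply: compact_setX; exact: subshift_compact.
- move=> j p; apply: cvgB.
    apply: (@continuous_comp _ _ _ fst (enum_coord j)); first exact: cvg_fst.
    exact: enum_coord_continuous.
  apply: (@continuous_comp _ _ _ snd (enum_coord j)); first exact: cvg_snd.
  exact: enum_coord_continuous.
- exact: compatible_metric_continuous.
- suff /d_eq0 -> : p.1 = p.2 by [].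
  by apply: enum_coord_inj => j; apply/eqP; rewrite -subr_eq0 pP.
pose l : seq (int * I) := pmap unpickle (iota 0 n.+1).
pose M := maxn n (\max_(p <- l) `|p.1|.+1)%N.
exists M, [seq p.2 | p <- l] => L x y xy.
apply/bigmax_ltP; split => // k _.
apply: (nP (iter k (shift_on 1) x, iter k (shift_on 1) y)) => j jn /=.
rewrite /enum_coord; case ej: (unpickle j) => [[a i]|]; last first.
  by rewrite subrr normr0 invr_gt0 ltr0n.
have ail : (a, i) \in l.
  by rewrite mem_pmap; apply/mapP; exists j; rewrite ?ej // mem_iota.
have aM : (`|a| < M)%N.
  apply: leq_trans (leq_maxr _ _).
  exact: (@leq_bigmax_seq _ _ xpredT (fun p : int * I => `|p.1|.+1)%N (a, i)).
rewrite !coord_iter_shift.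
apply: lt_le_trans (_ : M.+1%:R^-1 <= _); last first.
  by rewrite lef_pV2 ?posrE ?ltr0n // ler_nat ltnS leq_maxl.
apply: xy; last by apply/mapP; exists (a, i).
by have := ltn_ord k; lia.
Qed.

(** The pieces of the coordinates in the window separate points at scale [e]. Only distinct interior
    values count: a coordinate equal to 0 or 1 is free. *)
Lemma subshift_widim_le (e : R) : 0 < e ->
  exists (M : nat) (s : seq I), forall (L n : nat),
    (forall x, exists2 vs : seq R, (size vs <= n)%N &
       forall (k : nat) i, (k < L + 2 * M)%N -> i \in s ->
         0 < coord x (k%:Z - M%:Z) i < 1 -> coord x (k%:Z - M%:Z) i \in vs) ->
    (widim (orbit_metric (shift_on 1) d L) e [set: set_type A] <= n%:R%:E)%E.
Proof.
move=> e0; have e2 : 0 < e / 2 by rewrite divr_gt0.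
have [M [s Ms]] := subshift_window e2.
exists M, s => L n xvs; set W := (L + 2 * M)%N in xvs.
pose Q := (2 * M.+1).+1.
have Q2 : 2 / Q%:R < M.+1%:R^-1 :> R.
  by rewrite ltr_pdivrMr // mulrC ltr_pdivlMr ?ltr0n // -natrM ltr_nat.
pose J := ('I_W * 'I_(size s) * 'I_Q)%type.
pose y (j : J) x := coord x ((j.1.1 : nat)%:Z - M%:Z) (tnth (in_tuple s) j.1.2).
have yc j : continuous (y j) by move=> x; exact: coord_continuous_set.
apply: (@widim_le R _ _ e (e / 2) _ J (fun j x => clamp (Q%:R * y j x - j.2%:R))).
- by lra.
- by move=> j; exact: continuous_piece.
- by move=> j x; exact: clamp_itv.
- move=> x _; have [vs vsn xP] := xvs x.
  exists [seq clamp (Q%:R * z - (Num.truncn (Q%:R * z))%:R) | z <- vs].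
    by rewrite size_map.
  move=> j uj; apply/mapP; exists (y j x); last by rewrite -(piece_interior uj).
  apply: xP; [exact: ltn_ord|exact: mem_tnth|].
  exact: pieces_interior (coord_itv x _ _) (ltn_ord _) uj.
- move=> x x' _ _ h01 h10; apply/ltW/Ms => a i aL /(tnthP (in_tuple s)) [j ->].
  apply: le_lt_trans Q2.
  have aW : (absz (a + M%:Z)%R < W)%N by rewrite /W; lia.
  have aE : a = (Ordinal aW : nat)%:Z - M%:Z by rewrite /=; lia.
  rewrite ler_distlC lerBlDr aE; apply/andP; split; apply: clamp_pieces_separate => //;
    try exact: coord_itv.
    by move=> h [hx hx']; apply: (h10 (Ordinal aW, j, h)).
  by move=> h [hx hx']; apply: (h01 (Ordinal aW, j, h)).
Qed.

(** By compactness a small [d] forces the coordinates at time 0 to differ by less than 1. The shift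
    reduces time [a] to time 0, so one [e] serves all [L]. *)
Lemma subshift_orbit_ge i : exists2 e : R, 0 < e & forall (L a : nat) x y,
  (a < L)%N -> 1 <= `|coord x a%:Z i - coord y a%:Z i| ->
  e <= orbit_metric (shift_on 1) d L x y.
Proof.
have [[_ d_eq0 _ _] _] := dc.
have [|||p pP|n nP] := @compact_uniform R (set_type A * set_type A)%type
   (fun j p => d p.1 p.2) (fun p => `|coord p.1 0 i - coord p.2 0 i|) 1.
- by rewrite -setXTT; apply: compact_setX; exact: subshift_compact.
- by move=> _; exact: compatible_metric_continuous.
- move=> p; apply: cvg_norm; apply: cvgB.
    apply: (@continuous_comp _ _ _ fst (fun x => coord x 0 i)); first exact: cvg_fst.
    exact: coord_continuous_set.
  apply: (@continuous_comp _ _ _ snd (fun x => coord x 0 i)); first exact: cvg_snd.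
  exact: coord_continuous_set.
- by have /d_eq0 -> := pP 0%N; rewrite subrr normr0 ltr01.
exists n.+1%:R^-1; first by rewrite invr_gt0 ltr0n.
move=> L a x y aL; rewrite !leNgt; apply: contraNN => dlt.
have := nP (iter a (shift_on 1) x, iter a (shift_on 1) y).
rewrite /= !coord_iter_shift add0r; apply => j _.
apply: le_lt_trans dlt; rewrite ger0_norm; last by case: dc => -[].
exact: (@le_bigmax _ _ _ 0 (fun k : 'I_L => d (iter k (shift_on 1) x)
  (iter k (shift_on 1) y)) (Ordinal aL)).
Qed.
End Subshift.

(** * Limits, order statistics and the triangle wave *)

Section Limits.
Context {R : realType}.
Local Open Scope ereal_scope.

(* [lim] of a diverging filter is the default point [0], whence [0 <= c]. *)
Lemma lim_le_near (T : Type) (F : set_system T) (f : T -> \bar R) (c : \bar R) :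
  ProperFilter F -> 0 <= c -> (\forall x \near F, f x <= c) -> lim (f @ F) <= c.
Proof.
move=> FF c0 fc; have [cf|ncf] := pselect (cvg (f @ F)); first exact: lime_le.
by rewrite dvgP.
Qed.

Lemma inve_nat (n : nat) : (0 < n)%N -> (n%:R)%:E^-1 = (n%:R^-1)%:E :> \bar R.
Proof. by move=> n0; rewrite inver pnatr_eq0 -leqn0 leqNgt n0. Qed.

Lemma near_ratio_le (f : nat -> \bar R) (a b c : R) : (a < c)%R ->
  (forall n, f n <= (a * n%:R + b)%:E) ->
  \forall n \near \oo, f n / (n%:R)%:E <= c%:E.
Proof.
move=> ac fn; near=> n.
have n0 : (0 < n)%N by near: n; exact: nbhs_infty_gt.
have n0R : (0 < n%:R :> R)%R by rewrite ltr0n.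
rewrite inve_nat // lee_pdivrMr // (le_trans (fn n)) // -EFinM lee_fin.
suff : (b <= (c - a) * n%:R)%R by lra.
rewrite mulrC -ler_pdivrMr ?subr_gt0 //.
near: n; exact: nbhs_infty_ger.
Unshelve. all: by end_near.
Qed.

Lemma near_ratio_ge1 (f : nat -> \bar R) : (forall n, n%:R%:E <= f n) ->
  \forall n \near \oo, 1 <= f n / (n%:R)%:E.
Proof.
move=> fn; near=> n; have n0 : (0 < n)%N by near: n; exact: nbhs_infty_gt.
by rewrite inve_nat // lee_pdivlMr ?ltr0n // mul1e.
Unshelve. all: by end_near.
Qed.

Lemma cvge_sandwich (T : Type) (F : set_system T) (f : T -> \bar R) (l : R) :
  Filter F ->
  (forall e : R, (0 < e)%R -> \forall x \near F, (l - e)%:E <= f x <= (l + e)%:E) ->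
  f @ F --> l%:E.
Proof.
move=> FF fl; apply/fine_cvgP; split.
  apply: filterS (fl 1%R ltr01) => x /andP[lf fu].
  by rewrite fin_numElt (lt_le_trans _ lf) ?ltNyr // (le_lt_trans fu) ?ltry.
apply/cvgrPdist_le => e e0; apply: filterS (fl e e0) => x /=.
case: (f x) => [r||] /=; rewrite ?leye_eq ?leeNy_eq ?andbF //.
by rewrite !lee_fin ler_distl => /andP[? ?]; apply/andP; split; lra.
Qed.
End Limits.

Section OrderStatistics.
Context {R : realType} {N : nat}.
Implicit Types (v : 'I_N -> R) (r : nat).

(* The value of rank [r] (from below, starting with rank 1) among the [v t]. *)
Definition order_stat r v : R :=
  \big[Num.min/1]_(A : {set 'I_N} | #|A| == r) \big[Num.max/0]_(t in A) v t.

Lemma order_stat_itv r v : 0 <= order_stat r v <= 1.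
Proof.
rewrite /order_stat bigmin_le_id andbT; apply: le_bigmin => // A _.
exact: bigmax_ge_id.
Qed.

Lemma card_le_order_stat r v : (forall t, v t <= 1) -> (r <= N)%N ->
  (r <= #|[set t | (v t <= order_stat r v)%R]%SET|)%N.
Proof.
move=> v1 rN.
have [A0 A0r] : exists A : {set 'I_N}, #|A| == r.
  exists [set widen_ord rN i | i : 'I_r]%SET.
  rewrite card_imset ?card_ord // => i j /(congr1 val) /= ij; exact: val_inj.
have [|A /eqP cA osE] := @eq_bigmin _ _ _ (1 : R) A0 (fun A : {set 'I_N} => #|A| == r)
  (fun A => \big[Num.max/0]_(t in A) v t) A0r.
  by move=> A _; apply: bigmax_le.
rewrite -[X in (X <= _)%N]cA /order_stat osE.
apply: subset_leq_card; apply/fintype.subsetP => t tA; rewrite inE.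
exact: le_bigmax_cond.
Qed.

Lemma card_lt_order_stat r v : (forall t, 0 <= v t) -> (0 < r)%N ->
  (#|[set t | (v t < order_stat r v)%R]%SET| < r)%N.
Proof.
move=> v0 r0; rewrite ltnNge; apply/negP => r_le.
set B := [set t | _]%SET in r_le.
pose A := [set t in take r (enum B)]%SET.
have cA : #|A| = r.
  rewrite cardsE; have /card_uniqP -> : uniq (take r (enum B)).
    by rewrite take_uniq // enum_uniq.
  by rewrite size_takel // -cardE.
have [t0 t0A] : exists t0, t0 \in A by apply/card_gt0P; rewrite cA.
have vA t : t \in A -> v t < order_stat r v.
  by rewrite inE => /mem_take; rewrite mem_enum inE.
have : order_stat r v <= \big[Num.max/0]_(t in A) v t.
  by apply: bigmin_le_cond; rewrite cA.
rewrite leNgt bigmax_lt // (le_lt_trans (v0 t0)) //; exact: vA.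
Qed.

Lemma continuous_order_stat (X : topologicalType) (f : 'I_N -> X -> R) r :
  (forall t, continuous (f t)) -> continuous (fun x => order_stat r (f^~ x)).
Proof.
by move=> fc; apply: continuous_bigmin => A; exact: continuous_bigmax.
Qed.

(** At least [j * m] values are at most [th j], and fewer than [j.+1 * m] lie below [th j.+1]. At
    [j = 0] the first bound is trivial; at [j = k] the total number [k.+1 * m] of values replaces
    the second. *)
Lemma card_between_order_stats (k m : nat) (th : nat -> R) v j :
  N = (k.+1 * m)%N -> (0 < m)%N -> (forall t, 0 <= v t <= 1) ->
  (forall l, (l < k)%N -> th l.+1 = order_stat (l.+1 * m) v) -> (j <= k)%N ->
  th j < th j.+1 ->
  (#|[set t | (th j < v t < th j.+1)%R]%SET| <= m)%N.
Proof.
move=> NE m0 v01 thE jk thj.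
pose B := [set t | (v t <= th j)%R]%SET.
set G := [set t | _]%SET.
have B_ge : (j * m <= #|B|)%N.
  case: j jk {thj G} @B => // j jk B; rewrite /B thE //.
  apply: card_le_order_stat => [t|]; first by case/andP: (v01 t).
  by rewrite NE leq_mul2r ltnW ?orbT // ltnS.
have GB_le : (#|G :|: B| <= j.+1 * m)%N.
  have [->|jk'] := eqVneq j k.
    by rewrite -NE -[X in (_ <= X)%N]card_ord max_card.
  have {}jk' : (j < k)%N by rewrite ltn_neqAle jk'.
  apply: (@leq_trans #|[set t | (v t < th j.+1)%R]%SET|).
    apply: subset_leq_card; apply/fintype.subsetP => t; rewrite !inE.
    by move=> /orP[/andP[]|/le_lt_trans] //; exact.
  rewrite thE //; apply: ltnW; apply: card_lt_order_stat; last by rewrite muln_gt0.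
  by move=> t; case/andP: (v01 t).
have GB0 : #|(G :&: B)%SET| = 0%N.
  apply: eq_card0 => t; rewrite !inE; apply/negP => /andP[/andP[h _]].
  by rewrite leNgt h.
have := cardsUI G B; rewrite GB0 addn0 => GBE.
move: GB_le; rewrite GBE mulSn => GB_le.
by rewrite -(leq_add2r #|B|) (leq_trans GB_le) // leq_add2l.
Qed.
End OrderStatistics.

Section Wave.
Context {R : realType}.
Implicit Types y a b : R.

(* The continuous triangle wave with slopes +1, -1, +1, ... on the first [Q]
   unit intervals. *)
Definition wave (Q : nat) y : R := \sum_(h < Q) (-1) ^+ h * clamp (y - h%:R).

(** The [h]-th monotone piece of the wave, continued by constants. Unlike the wave, the teeth with
    [h < Q] together determine a point of [[0, Q]]. *)
Definition tooth (h : nat) y : R :=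
  if odd h then 1 - clamp (y - h%:R) else clamp (y - h%:R).

Lemma waveS Q y : wave Q.+1 y = wave Q y + (-1) ^+ Q * clamp (y - Q%:R).
Proof. by rewrite /wave big_ord_recr. Qed.

Lemma wave_end Q y : Q%:R <= y -> wave Q y = (odd Q)%:R.
Proof.
elim: Q => [|Q IH] Qy; first by rewrite /wave big_ord0.
move: Qy; rewrite -[Q.+1]addn1 natrD => Qy; rewrite addn1 waveS IH; last by lra.
rewrite clamp_ge1 ?mulr1; last by lra.
by rewrite -signr_odd /=; case: (odd Q); rewrite /= ?expr1 ?expr0; lra.
Qed.

Lemma wave_tooth Q h y : (h < Q)%N -> h%:R <= y <= h.+1%:R -> wave Q y = tooth h y.
Proof.
elim: Q => // Q IH; rewrite ltnS leq_eqVlt => /orP[/eqP ->|hQ] /andP[hy yh].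
  rewrite waveS wave_end // /tooth -signr_odd.
  by case: (odd Q); rewrite /= ?expr1 ?expr0 ?mulN1r ?mul1r ?add0r.
rewrite waveS IH // ?hy // clamp_le0 ?mulr0 ?addr0 // subr_le0 (le_trans yh) //.
by rewrite ler_nat.
Qed.

Lemma tooth_itv h y : 0 <= tooth h y <= 1.
Proof. by rewrite /tooth; have := clamp_itv (y - h%:R); case: ifP => _ /andP[]; lra. Qed.

Lemma wave_itv Q y : 0 <= y <= Q%:R -> 0 <= wave Q y <= 1.
Proof.
move=> /andP[y0]; rewrite le_eqVlt => /orP[/eqP ->|yQ].
  by rewrite wave_end //; case: (odd Q); rewrite /= lexx ler01.
have /andP[ty yt] := truncn_itv y0.
have tQ : (Num.truncn y < Q)%N by rewrite -(ltr_nat R); exact: le_lt_trans yQ.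
by rewrite (wave_tooth tQ) ?tooth_itv // ty ltW.
Qed.

Lemma continuous_wave (X : topologicalType) (f : X -> R) Q :
  continuous f -> continuous (fun z => wave Q (f z)).
Proof.
move=> fc; apply: continuous_bigsum => h z; apply: cvgM; first exact: cvg_cst.
apply: (@continuous_clamp _ _ (fun z => f z - h%:R)) => x.
by apply: cvgB; [exact: fc|exact: cvg_cst].
Qed.

Lemma continuous_tooth (X : topologicalType) (f : X -> R) h :
  continuous f -> continuous (fun z => tooth h (f z)).
Proof.
move=> fc; rewrite /tooth; have cc : continuous (fun z => clamp (f z - h%:R)).
  by apply: continuous_clamp => x; apply: cvgB; [exact: fc|exact: cvg_cst].
by case: (odd h) => // z; apply: cvgB; [exact: cvg_cst|exact: cc].
Qed.

Definition gate a b y : R := clamp ((y - a) / (b - a)).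

Lemma continuous_gate (X : topologicalType) (f : X -> R) a b :
  continuous f -> continuous (fun z => gate a b (f z)).
Proof.
move=> fc; rewrite (_ : (fun z => _) =
  (fun z => clamp ((b - a)^-1 * f z - a / (b - a)))); last first.
  by apply/funext => z; rewrite /gate mulrBl [_^-1 * _]mulrC.
exact: continuous_piece.
Qed.

Lemma gate_itv a b y : 0 <= gate a b y <= 1.
Proof. exact: clamp_itv. Qed.

Lemma gate_interior a b y : a < b -> 0 < gate a b y < 1 -> a < y < b.
Proof.
move=> ab /clamp_interior; have ba : 0 < b - a by rewrite subr_gt0.
by rewrite ltr_pdivlMr // mul0r subr_gt0 ltr_pdivrMr // mul1r ltrD2r.
Qed.

Lemma gate0 a b : 0 <= a < b -> gate a b 0 = 0.
Proof.
move=> /andP[a0 ab]; apply: clamp_le0.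
by rewrite ler_pdivrMr ?subr_gt0 // mul0r sub0r oppr_le0.
Qed.

Lemma gate1 a b : a < b <= 1 -> gate a b 1 = 1.
Proof.
move=> /andP[ab b1]; apply: clamp_ge1.
by rewrite ler_pdivlMr ?subr_gt0 // mul1r lerD2r.
Qed.

(** A gated tooth is interior only where the tooth is, hence where it coincides with the wave. Its
    value then depends on the wave value alone, so a coordinate contributes at most one interior
    value, and none unless its wave value lies in the gap. *)
Lemma gate_tooth_interior Q h a b y : (h < Q)%N -> 0 <= a < b -> b <= 1 ->
  0 < gate a b (tooth h y) < 1 -> a < wave Q y < b /\ tooth h y = wave Q y.
Proof.
move=> hQ /andP[a0 ab] b1 /(gate_interior ab) /andP[ah hb].
suff we : wave Q y = tooth h y by rewrite we ah hb.
apply: wave_tooth => //; have : 0 < clamp (y - h%:R) < 1.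
  by move: ah hb; rewrite /tooth; case: ifP => _; lra.
by move=> /clamp_interior; rewrite -[h.+1]addn1 natrD; lra.
Qed.

(** The gate fixes 0 and 1, so the criterion of [clamp_pieces_separate] passes through it; odd teeth
    exchange the roles of the two hypotheses. *)
Lemma gate_tooth_separate Q a b x y : (0 < Q)%N -> 0 <= a < b -> b <= 1 ->
  0 <= x <= 1 -> 0 <= y <= 1 ->
  (forall h : 'I_Q, ~ (gate a b (tooth h (Q%:R * x)) = 0 /\
                       gate a b (tooth h (Q%:R * y)) = 1)) ->
  (forall h : 'I_Q, ~ (gate a b (tooth h (Q%:R * x)) = 1 /\
                       gate a b (tooth h (Q%:R * y)) = 0)) ->
  `|x - y| <= 2 / Q%:R.
Proof.
move=> Q0 ab b1 x01 y01 h01 h10.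
have g0 := gate0 ab; have g1 : gate a b 1 = 1 by apply: gate1; case/andP: ab => _ ->.
rewrite ler_distlC lerBlDr; apply/andP; split.
  apply: clamp_pieces_separate => // h [hx hy].
  by case: (boolP (odd h)) => oh; [apply: (h01 h)|apply: (h10 h)];
    rewrite /tooth ?oh ?(negPf oh) hx hy ?subr0 ?subrr.
apply: clamp_pieces_separate => // h [hx hy].
by case: (boolP (odd h)) => oh; [apply: (h10 h)|apply: (h01 h)];
  rewrite /tooth ?oh ?(negPf oh) hx hy ?subr0 ?subrr.
Qed.

Lemma ex_gap (k : nat) (th : nat -> R) :
  th 0%N < th k -> exists2 j, (j < k)%N & th j < th j.+1.
Proof.
elim: k => [|k IH]; first by rewrite ltxx.
have [kk _|kk] := ltP (th k) (th k.+1); first by exists k.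
by move=> /lt_le_trans /(_ kk) /IH[j jk hj]; exists j => //; rewrite ltnS ltnW.
Qed.
End Wave.

(** * The factor map *)

Section Markers.

Definition marker (N : nat) (r a : int) : bool := (N%:Z %| a - r)%Z.

Lemma marker_shift N r z a : marker N (r - z) a = marker N r (a + z).
Proof. by rewrite /marker opprB addrCA addrC addrAC -addrA addrCA addrA. Qed.

Lemma marker_ord N r : (0 < N)%N -> exists r' : 'I_N, forall a, marker N r' a = marker N r a.
Proof.
move=> N0; have N0z : N%:Z != 0 by rewrite -lt0n.
have rN : (absz (r %% N)%Z < N)%N.
  by rewrite -ltz_nat gez0_abs ?modz_ge0 // ltz_pmod // ltz_nat.
exists (Ordinal rN) => a; rewrite /marker /= gez0_abs ?modz_ge0 //.
rewrite -!eqz_mod_dvd; apply/idP/idP => /eqP h; apply/eqP; rewrite h ?modz_mod //.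
Qed.

Lemma marker_nat N (r i : nat) : (r < N)%N -> marker N r i -> (i = r + N * (i %/ N))%N.
Proof.
move=> rN; rewrite /marker -eqz_mod_dvd !modz_nat => /eqP [] ir.
by rewrite {1}(divn_eq i N) ir modn_small // mulnC addnC.
Qed.

Lemma marker_add_period N r a q : marker N r (a + N%:Z * q) = marker N r a.
Proof. by rewrite /marker addrAC rpredDr // dvdz_mulr. Qed.

Lemma marker_self N r : marker N r r.
Proof. by rewrite /marker subrr. Qed.
End Markers.

Section Systems.
Context {R : realType}.
Variable C : nat.
Hypothesis C_gt0 : (0 < C)%N.

Definition block_rank n := (C * 2 ^ n.+1)%N.
Definition period n := (n.+1 * block_rank n)%N.

Lemma block_rank_gt0 n : (0 < block_rank n)%N.
Proof. by rewrite muln_gt0 C_gt0 expn_gt0. Qed.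

Lemma period_gt0 n : (0 < period n)%N.
Proof. by rewrite muln_gt0 block_rank_gt0. Qed.

(* Channel [0] is the full shift over [0, 1]; channel [n.+1] marks the
   beginnings of the blocks of length [period n]. *)
Definition marked_set : set {ptws int * nat -> R} :=
  [set w | (forall a, 0 <= w (a, 0%N) <= 1) /\
     forall n, exists r : 'I_(period n), forall a,
       w (a, n.+1) = (marker (period n) r a)%:R].

Lemma marked_set_itv w p : marked_set w -> 0 <= w p <= 1.
Proof.
case: p => a [|n] [w0 wm]; first exact: w0.
by have [r ->] := wm n; case: (marker _ _ _); rewrite /= ?lexx ler01.
Qed.

(** The phases [r] form a finite set, so the union over them of closed conditions is closed. *)
Lemma marked_set_compact : compact marked_set.
Proof.
apply: (@subclosed_compact _ _ [set w : {ptws int * nat -> R} | forall p, `[0, 1]%classic (w p)]).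
- have -> : marked_set =
    (\bigcap_a [set w : {ptws int * nat -> R} | `[0, 1]%classic (w (a, 0%N))]) `&`
    (\bigcap_n \bigcup_(r in [set: 'I_(period n)]) \bigcap_a
      [set w : {ptws int * nat -> R} | w (a, n.+1) = (marker (period n) r a)%:R]).
    apply/seteqP; split => w [w0 wm]; split.
    + by move=> a _ /=; rewrite in_itv /=.
    + by move=> n _; have [r wr] := wm n; exists r => // a _; exact: wr.
    + by move=> a; have := w0 a I; rewrite /= in_itv.
    + by move=> n; have [r _ wr] := wm n I; exists r => a; exact: wr.
  apply: closedI.
    apply: closed_bigI => a _; apply: ((continuous_closedP _).1 (@continuous_proj R _ (a, 0%N))).
    exact: interval_closed.
  apply: closed_bigI => n _; apply: closed_bigcup; first exact: finite_finset.
  move=> r _; apply: closed_bigI => a _.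
  apply: ((continuous_closedP _).1 (@continuous_proj R _ (a, n.+1)) [set x | x = _]).
  exact: closed_eq.
- by apply: (@tychonoff _ (fun=> R) (fun=> `[0, 1]%classic)) => p; exact: segment_compact.
- by move=> w wM p; rewrite /= in_itv /=; exact: marked_set_itv.
Qed.

Lemma marked_set_shift z w : marked_set w -> marked_set (shift z w).
Proof.
move=> [w0 wm]; split=> [a|n]; first exact: w0.
have [r wr] := wm n; have [r' rr'] := marker_ord (r%:Z - z) (period_gt0 n).
by exists r' => a; rewrite rr' marker_shift -wr.
Qed.

Definition block_wave n (w : {ptws int * nat -> R}) (a : int) (t : 'I_(period n)) : R :=
  wave n.+1 (n.+1%:R * w (a + (t : nat)%:Z, 0%N)).

(* At the beginning of a block, channel [(n, l.+1)] carries the order statistic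
   of rank [l.+1 * block_rank n] of the wave values in that block. *)
Definition code (w : {ptws int * nat -> R}) : {ptws int * (nat * nat) -> R} :=
  fun p => let: (a, (n, l)) := p in
    if l is l'.+1 then
      if (l' < n)%N then w (a, n.+1) * order_stat (l * block_rank n) (@block_wave n w a) else 0
    else w (a, n.+1).

(** The marker enters [code] as a factor and not as a test, so continuity follows from that of
    products. *)
Lemma code_continuous : continuous code.
Proof.
apply: continuous_ptws => -[a [n [|l]]] /=; first exact: continuous_proj.
case: (l < n)%N; last exact: cst_continuous.
apply: continuous_mulr; first exact: continuous_proj.
apply: (@continuous_order_stat _ _ _ (fun t w => @block_wave n w a t)) => t.
apply: continuous_wave; apply: continuous_mulr; first exact: cst_continuous.
exact: continuous_proj.
Qed.

Lemma code_shift z w : code (shift z w) = shift z (code w).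
Proof.
apply/funext => -[a [n [|l]]] //=; rewrite /shift /=; case: ifP => // _.
congr (_ * order_stat _ _); apply/funext => t.
by rewrite /block_wave /shift /= addrAC.
Qed.

Definition code_set : set {ptws int * (nat * nat) -> R} := code @` marked_set.

Lemma code_set_compact : compact code_set.
Proof.
apply: continuous_compact; last exact: marked_set_compact.
by apply: continuous_subspaceT; exact: code_continuous.
Qed.

Lemma code_set_shift z w : code_set w -> code_set (shift z w).
Proof.
by move=> [v vm <-]; exists (shift z v); rewrite ?code_shift //; exact: marked_set_shift.
Qed.

Lemma code_set_itv w p : code_set w -> 0 <= w p <= 1.
Proof.
case: p => a [n l] [v vm <-] /=.
have /andP[v0 v1] := marked_set_itv (a, n.+1) vm.
case: l => [|l]; first by rewrite v0 v1.
case: ifP => _; last by rewrite lexx ler01.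
have /andP[st0 st1] := order_stat_itv (l.+1 * block_rank n) (@block_wave n v a).
by rewrite mulr_ge0 // mulr_ile1.
Qed.

Notation X := (set_type marked_set).
Notation Y := (set_type code_set).

Definition code_factor (x : X) : Y :=
  SigSub (mem_set (imageP code (set_valP x))).

Lemma code_factor_map :
  factor_map (shift_on marked_set_shift 1) (shift_on code_set_shift 1) code_factor.
Proof.
split.
- apply: (@continuous_to_set _ _ code_set) => a i x.
  apply: (@continuous_comp _ _ _ (@set_val _ marked_set) (fun w => code w (a, i))).
    exact: initial_continuous.
  apply: (@continuous_comp _ _ _ code (fun w => w (a, i))).
    exact: code_continuous.
  exact: continuous_proj.
- move=> y _; have [w wm wy] := set_valP y.
  by exists (SigSub (mem_set wm)) => //; apply: val_inj.
- by move=> x; apply: val_inj => /=; rewrite -code_shift.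
Qed.

Lemma coord_marked (x : X) n : exists r : int, forall a,
  coord x a n.+1 = (marker (period n) r a)%:R.
Proof. by have [r xr] := (set_valP x).2 n; exists r. Qed.

Lemma coord_marked0 (x : X) a n : ~ (0 < coord x a n.+1 < 1).
Proof.
have [r ->] := coord_marked x n.
by case: (marker _ _ _) => /andP[]; rewrite /= ltxx.
Qed.

Lemma coord_code_factor (x : X) a i : coord (code_factor x) a i = code (set_val x) (a, i).
Proof. by []. Qed.

(** * Widths of the two systems and of the fibres *)

Notation T := (shift_on marked_set_shift 1).
Notation S := (shift_on code_set_shift 1).

(** Markers are never interior, so only the [L + 2 * M] values of channel 0 in the window count. *)
Lemma widim_marked_le (d : X -> X -> R) (e : R) : compatible_metric d -> 0 < e ->
  exists M : nat, forall L : nat,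
    (widim (orbit_metric T d L) e [set: X] <= (L + 2 * M)%:R%:E)%E.
Proof.
move=> dc e0.
have [M [s sM]] := subshift_widim_le marked_set_compact marked_set_itv marked_set_shift dc e0.
exists M => L; apply: sM => x.
exists [seq coord x (k%:Z - M%:Z) 0%N | k <- iota 0 (L + 2 * M)].
  by rewrite size_map size_iota.
move=> k [|i] kL _ xk; last by case: (coord_marked0 xk).
by apply/mapP; exists k; rewrite // mem_iota.
Qed.

(** A discretised [L]-cube, with all phases 0 and channel 0 vanishing outside the times
    [0, ..., L - 1]. The truncation by [m] keeps the values in [[0, 1]] for every [w]. *)
Definition cube_seq (m : nat) (L : nat) (w : {ffun 'I_L -> nat}) : {ptws int * nat -> R} :=
  fun p => if p.2 is n.+1 then (marker (period n) 0 p.1)%:R else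
    if p.1 is Posz k then
      if insub k is Some i then (minn (w i) m)%:R / m%:R else 0
    else 0.

Lemma cube_seq_marked m L (w : {ffun 'I_L -> nat}) : marked_set (cube_seq m.+1 w).
Proof.
split=> [a|n]; last by exists (Ordinal (period_gt0 n)).
rewrite /cube_seq /=; case: a => [k|k]; last by rewrite lexx ler01.
case: (insub k : option 'I_L) => [i|]; last by rewrite lexx ler01.
by rewrite divr_ge0 //= ler_pdivrMr ?ltr0n // mul1r ler_nat geq_minr.
Qed.

Definition cube_point m L (w : {ffun 'I_L -> nat}) : X :=
  SigSub (mem_set (cube_seq_marked m w)).

Lemma coord_cube_point m L (w : {ffun 'I_L -> nat}) (i : 'I_L) :
  coord (cube_point m w) (i : nat)%:Z 0%N = (minn (w i) m.+1)%:R / m.+1%:R.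
Proof.
rewrite (_ : coord _ _ _ = cube_seq m.+1 w ((i : nat)%:Z, 0%N)) // /cube_seq /=.
by rewrite (valK i).
Qed.

Lemma coord_cube_point_lip m L (w w' : {ffun 'I_L -> nat}) a i :
  (forall j, w j <= w' j <= (w j).+1)%N ->
  `|coord (cube_point m w) a i - coord (cube_point m w') a i| <= m.+1%:R^-1.
Proof.
move=> ww'; have inv0 : 0 <= m.+1%:R^-1 :> R by rewrite invr_ge0 ler0n.
rewrite -[coord (cube_point m w) a i]/(cube_seq m.+1 w (a, i)).
rewrite -[coord (cube_point m w') a i]/(cube_seq m.+1 w' (a, i)) /cube_seq /=.
case: i => [|n]; last by rewrite subrr normr0.
case: a => [k|k]; last by rewrite subrr normr0.
case: (insub k : option 'I_L) => [i|]; last by rewrite subrr normr0.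
rewrite -mulrBl normrM [X in _ * X]ger0_norm // ler_piMl // ler_norml.
have /andP[w1 w2] := ww' i.
have h1 : (minn (w i) m.+1 <= minn (w' i) m.+1)%N by lia.
have h2 : (minn (w' i) m.+1 <= (minn (w i) m.+1).+1)%N by lia.
move: h1 h2; rewrite -!(ler_nat R) -[(minn (w i) m.+1).+1]addn1 natrD => h1 h2.
by apply/andP; split; lra.
Qed.

(** The sets where channel 0 at time [i < L] is 0, respectively 1, are at orbit distance at least
    [e0], with [e0] independent of [L]; [widim_ge] applies to them. *)
Lemma widim_marked_ge (d : X -> X -> R) : compatible_metric d ->
  exists2 e0 : R, 0 < e0 & forall (e : R) (L : nat), e <= e0 ->
    (L%:R%:E <= widim (orbit_metric T d L) e [set: X])%E.
Proof.
move=> dc.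
have [e0 e00 dge] := subshift_orbit_ge marked_set_compact marked_set_shift dc 0%N.
exists e0 => // e L ee0.
apply: (@widim_ge R X (@enum_coord R nat marked_set) _ _ L
  (fun i => [set x | coord x (i : nat)%:Z 0%N = 0])
  (fun i => [set x | coord x (i : nat)%:Z 0%N = 1])
  (fun m w => cube_point m.-1 w)).
- exact: compact_set_type marked_set_compact.
- exact: enum_coord_continuous.
- exact: enum_coord_inj.
- apply: orbit_metric_continuous => //; exact: shift_on_continuous.
- move=> i x y /= x0 y1; apply: le_trans ee0 _; apply: (dge L i) => //.
  by rewrite x0 y1 sub0r normrN normr1.
- by move=> i m w wi /=; rewrite coord_cube_point wi min0n mul0r.
- by move=> i m w wi /=; rewrite coord_cube_point wi minnn divff // pnatr_eq0.
- move=> j m w w' ww'; rewrite /enum_coord /=; case: unpickle => [[a i]|].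
    exact: coord_cube_point_lip.
  by rewrite subrr normr0 invr_ge0 ler0n.
Qed.

(** Positions in the window are counted from time [-M]; [r'] is the first one that carries a
    marker. *)
Lemma ex_offset n (r : int) (M : nat) : exists r' : nat, (r' < period n)%N /\
  forall a, marker (period n) r' a = marker (period n) r (a - M%:Z).
Proof.
have [r' rr'] := marker_ord (r + M%:Z) (period_gt0 n).
by exists r'; split=> // a; rewrite rr' -[in LHS](opprK M%:Z) marker_shift.
Qed.

(** A window of length [W] contains at most [W %/ period n + 1] beginnings of blocks, each with [n]
    order statistics. All other coordinates are 0 or 1, and only indices [n < B] are visible at
    scale [e]. *)
Lemma widim_code_le (d : Y -> Y -> R) (e : R) : compatible_metric d -> 0 < e ->
  exists B M : nat, forall L : nat,
    (widim (orbit_metric S d L) e [set: Y] <=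
     (\sum_(n < B) n * ((L + 2 * M) %/ period n).+1)%:R%:E)%E.
Proof.
move=> dc e0.
have [M [s sM]] := subshift_widim_le code_set_compact code_set_itv code_set_shift dc e0.
pose B := (\max_(c <- s) c.1.+1)%N.
exists B, M => L; apply: sM => y; set W := (L + 2 * M)%N.
have [w wm wy] := set_valP y.
pose x : X := SigSub (mem_set wm).
have yx : y = code_factor x by apply: val_inj.
have [r xr] := choice (coord_marked x).
have [r' rr'] := choice (fun n => ex_offset n (r n) M).
pose vs n l := [seq coord y ((r' n + period n * q)%N%:Z - M%:Z) (n, l.+1) |
  q <- iota 0 (W %/ period n).+1].
exists (flatten [seq flatten [seq vs n l | l <- iota 0 n] | n <- iota 0 B]).
  rewrite size_flatten /shape -map_comp sumnE big_map.
  rewrite -[in X in (_ <= X)%N](big_mkord xpredT (fun n => n * (W %/ period n).+1)%N).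
  rewrite /index_iota subn0; apply: leq_sum => n _ /=.
  rewrite size_flatten /shape -map_comp sumnE big_map.
  under eq_bigr do rewrite /= size_map size_iota.
  by rewrite big_const_seq iter_addn_0 count_predT size_iota mulnC.
move=> k [n l] kW cs; rewrite yx coord_code_factor /=.
case: l cs => [|l] cs; first by move=> h; case: (@coord_marked0 x (k%:Z - M%:Z) n).
case: (ltnP l n) => [ln|_]; last by rewrite ltxx.
move=> yk.
have km : marker (period n) (r n) (k%:Z - M%:Z).
  move: yk; rewrite -[set_val x _]/(coord x (k%:Z - M%:Z) n.+1) xr.
  by case: (marker _ _ _) => //; rewrite mul0r ltxx.
apply/flattenP; exists (flatten [seq vs n l0 | l0 <- iota 0 n]).
  apply/mapP; exists n => //; rewrite mem_iota /=.
  exact: (@leq_bigmax_seq _ _ xpredT (fun c : nat * nat => c.1.+1) (n, l.+1)).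
apply/flattenP; exists (vs n l); first by apply/mapP; exists l; rewrite // mem_iota.
apply/mapP; exists (k %/ period n)%N.
  by rewrite mem_iota /= add0n ltnS leq_div2r // ltnW.
have [rn rr'n] := rr' n; rewrite -(@marker_nat (period n) (r' n) k) ?rr'n //.
by rewrite yx coord_code_factor /= ln.
Qed.

(* On a fibre the order statistics of every block are prescribed, and two
   consecutive ones, [th q j < th q j.+1], enclose at most [block_rank n] of the
   values of the wave. *)
Lemma widim_fibre_le (d : X -> X -> R) (e : R) : compatible_metric d -> 0 < e ->
  exists M n0 : nat, forall n (L : nat) (y : Y), (n0 <= n)%N ->
    (widim (orbit_metric T d L) e (code_factor @^-1` [set y]) <=
     (((L + 2 * M) %/ period n).+2 * block_rank n)%:R%:E)%E.
Proof.
move=> dc e0; have e2 : 0 < e / 2 by rewrite divr_gt0.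
have [M [s Ms]] := subshift_window marked_set_compact marked_set_shift dc e2.
exists M, (2 * M.+1)%N => n L y Mn; set W := (L + 2 * M)%N; set N := period n.
have N0 : (0 < N)%N := period_gt0 n.
have [x0 _ x0y] : exists2 x0, True & code_factor x0 = y.
  by have [_ pis _] := code_factor_map; have [x0 _ <-] := pis y I; exists x0.
have [r x0r] := coord_marked x0 n.
(* Channel [(n, 0)] of [y] shows the markers, so all points of the fibre have the same blocks. *)
have xr x a : code_factor x = y -> coord x a n.+1 = (marker N r a)%:R.
  by rewrite -x0r -x0y => /(congr1 (fun y => coord y a (n, 0%N))).
have [r' [r'N rr']] := ex_offset n r M.
(* Beginning of block [q]. The shift by one makes block 0 begin before the window, which is then
   covered by [(W %/ N).+2] blocks. *)
pose b (q : nat) : int := r'%:Z + N%:Z * (q%:Z - 1) - M%:Z.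
have br q : marker N r (b q) by rewrite -rr' marker_add_period marker_self.
(* The end values 0 and 1 guarantee a gap in every block. The gap is read off from [y], so the gates
   are the same on the whole fibre. *)
pose th q j : R := if j is l.+1 then
  if (l < n)%N then coord y (b q) (n, l.+1) else 1 else 0.
have th01 q j : 0 <= th q j <= 1.
  rewrite /th; case: j => [|l]; first by rewrite lexx ler01.
  by case: ifP => _; [exact: (coord_itv code_set_itv)|rewrite ler01 lexx].
have gap q : exists j, (j <= n)%N /\ th q j < th q j.+1.
  have [|j jn thj] := @ex_gap R n.+1 (th q).
    by rewrite /th ltnn ltr01.
  by exists j.
have [g gP] := choice gap.
pose al q := th q (g q); pose be q := th q (g q).+1.
have al0 q : 0 <= al q < be q by case/andP: (th01 q (g q)) => -> _; case: (gP q).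
have be1 q : be q <= 1 by case/andP: (th01 q (g q).+1).
pose pos (x : X) q (t : 'I_N) : R := coord x (b q + (t : nat)%:Z) 0%N.
have pos01 x q t : 0 <= pos x q t <= 1 by exact: (coord_itv marked_set_itv).
pose ch (i : 'I_(size s)) : nat := tnth (in_tuple s) i.
pose J := ('I_(W %/ N).+2 * 'I_N * 'I_n.+1 + 'I_W * 'I_(size s))%type.
pose u (j : J) (x : X) : R := match j with
  | inl qth => gate (al qth.1.1) (be qth.1.1)
      (tooth qth.2 (n.+1%:R * pos x qth.1.1 qth.1.2))
  | inr ki => if ch ki.2 is c.+1
      then coord x ((ki.1 : nat)%:Z - M%:Z) c.+1 else 0
  end.
apply: (@widim_le R _ _ e (e / 2) _ J u).
- by lra.
- move=> [[[q t] h]|[k i]]; last first.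
    case chi : (ch i) => [|c].
      rewrite (_ : u _ = fun=> 0); first exact: cst_continuous.
      by apply/funext => x; rewrite /u /= chi.
    rewrite (_ : u _ = fun x => coord x ((k : nat)%:Z - M%:Z) c.+1).
      by move=> x; exact: coord_continuous_set.
    by apply/funext => x; rewrite /u /= chi.
  apply: continuous_gate; apply: continuous_tooth; apply: continuous_mulr.
    exact: cst_continuous.
  by move=> x; exact: coord_continuous_set.
- move=> [[[q t] h]|[k i]] x /=; first exact: gate_itv.
  by case: (ch i) => [|c]; [rewrite lexx ler01|exact: (coord_itv marked_set_itv)].
- move=> x xy.
  pose v q := @block_wave n (set_val x) (b q).
  have vE q t : v q t = wave n.+1 (n.+1%:R * pos x q t) by [].
  pose G q := [set t | (al q < v q t < be q)%R]%SET.
  have G_le q : (#|G q| <= block_rank n)%N.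
    have [gn thg] := gP q.
    apply: (@card_between_order_stats R N n (block_rank n) (th q)) => //.
    - exact: block_rank_gt0.
    - move=> t; rewrite vE; apply: wave_itv; have /andP[p0 p1] := pos01 x q t.
      by rewrite mulr_ge0 ?ler0n //= ler_piMr ?ler0n.
    - move=> l ln; rewrite /th ln -xy coord_code_factor /= ln.
      by rewrite -[set_val x _]/(coord x (b q) n.+1) xr // br mul1r.
  exists (flatten [seq [seq gate (al q) (be q) (v q t) | t <- enum (G q)] |
    q <- iota 0 (W %/ N).+2]).
    rewrite size_flatten /shape -map_comp sumnE big_map.
    apply: (@leq_trans (\sum_(q <- iota 0 (W %/ N).+2) block_rank n)).
      by apply: leq_sum => q _; rewrite /= size_map -cardE.
    by rewrite big_const_seq iter_addn_0 count_predT size_iota mulnC.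
  move=> [[[q t] h]|[k i]]; last first.
    rewrite /u /=; case: (ch i) => [|c]; first by rewrite ltxx.
    by move=> h; case: (coord_marked0 h).
  move=> uj; have [vab vtooth] := gate_tooth_interior (ltn_ord h) (al0 q) (be1 q) uj.
  apply/flattenP; exists [seq gate (al q) (be q) (v q t) | t <- enum (G q)].
    by apply/mapP; exists (q : nat); rewrite // mem_iota /= add0n.
  apply/mapP; exists t; first by rewrite mem_enum inE vE.
  by rewrite /u /= vtooth.
- move=> x x' xy x'y h01 h10; apply/ltW/Ms => a i aL /(tnthP (in_tuple s)) [j ij].
  have aW : (absz (a + M%:Z)%R < W)%N by rewrite /W; lia.
  pose k := Ordinal aW.
  have ak : a = (k : nat)%:Z - M%:Z by rewrite /=; lia.
  case: i ij => [|c] ij; last first.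
    have chj : ch j = c.+1 by rewrite /ch -ij.
    have [rho xrho] := coord_marked x c; have [rho' xrho'] := coord_marked x' c.
    have := h01 (inr (k, j)); have := h10 (inr (k, j)); rewrite /u /= chj -ak xrho xrho'.
    case: (marker _ rho _); case: (marker _ rho' _) => H1 H2.
    + by rewrite subrr normr0 invr_gt0 ltr0n.
    + by case: H1.
    + by case: H2.
    + by rewrite subrr normr0 invr_gt0 ltr0n.
  (* The position counted from [b 0]; division by [N] gives the block and the place in it. *)
  pose k' := (k + (N - r'))%N.
  have k'q : (k' %/ N < (W %/ N).+2)%N.
    have kWN : (k' <= W + N)%N by rewrite leq_add ?leq_subr // ltnW // ltn_ord.
    by rewrite ltnS (leq_trans (leq_div2r N kWN)) // divnDr // divnn N0 addn1.
  pose q := Ordinal k'q; pose t := Ordinal (ltn_pmod k' N0).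
  have abt : a = b q + (t : nat)%:Z.
    have k'E : (k + (N - r') = N * (k' %/ N) + k' %% N)%N.
      by rewrite [(N * _)%N]mulnC -divn_eq.
    rewrite [LHS]ak /b mulrBr mulr1 -PoszM.
    have : (t : nat) = (k' %% N)%N by []; have : (q : nat) = (k' %/ N)%N by [].
    by move: r'N k'E; rewrite -/N => ? ? -> ->; lia.
  apply: (@le_lt_trans _ _ (2 / n.+1%:R)).
    rewrite abt; apply: (gate_tooth_separate (ltn0Sn n) (al0 q) (be1 q)).
    + exact: (coord_itv marked_set_itv).
    + exact: (coord_itv marked_set_itv).
    + by move=> h; exact: (h01 (inl (q, t, h))).
    + by move=> h; exact: (h10 (inl (q, t, h))).
  by rewrite ltr_pdivrMr ?ltr0n // mulrC ltr_pdivlMr ?ltr0n // -natrM ltr_nat ltnS.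
Qed.

(** * The mean dimensions *)

Lemma widim_ge0 (Z : topologicalType) (d : Z -> Z -> R) (e : R) (A : set Z) :
  (0 <= widim d e A)%E.
Proof. by apply: le_ereal_inf_tmp => _ [n _ <-]; rewrite lee_fin. Qed.

Lemma mdim_marked (d : X -> X -> R) : compatible_metric d -> mdim T d = 1%E.
Proof.
move=> dc; have [e0 e00 wge] := widim_marked_ge dc.
(* For each positive [e] up to [e0] the limit over [L] is already 1. *)
apply: lim_near_cst => //; near=> e.
have e_gt0 : 0 < e by near: e; exact: nbhs_right_gt.
have e_le : e <= e0 by near: e; exact: nbhs_right_le.
have [M wle] := widim_marked_le dc e_gt0.
apply: cvg_lim => //; apply: cvge_sandwich => eps eps0.
have h1 := near_ratio_ge1 (fun L => wge e L e_le).
have h2 : \forall L \near \oo,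
    (widim (orbit_metric T d L) e [set: X] / (L%:R)%:E <= (1 + eps)%:E)%E.
  apply: (@near_ratio_le _ _ 1 (2 * M)%N%:R); first by rewrite ltrDl.
  by move=> L; rewrite mul1r -natrD; exact: wle.
apply: filterS2 h1 h2 => L h1 h2; rewrite h2 andbT.
by apply: le_trans h1; rewrite lee_fin; lra.
Unshelve. all: by end_near.
Qed.

Lemma code_rank_le (B W : nat) :
  (\sum_(n < B) n * (W %/ period n).+1)%:R <=
  W%:R / C%:R + (\sum_(n < B) n)%:R :> R.
Proof.
have C0 : 0 < C%:R :> R by rewrite ltr0n.
(* Index [n] costs at most the share [2^-(n + 1)] of [W / C]; keeping the exact geometric sum lets
   the induction close. *)
suff : (\sum_(n < B) n * (W %/ period n).+1)%:R <=
    W%:R / C%:R * (1 - 2^-1 ^+ B) + (\sum_(n < B) n)%:R :> R.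
  move=> h; apply: le_trans h _; rewrite lerD2r ler_piMr ?divr_ge0 ?ler0n //.
elim: B => [|B IH]; first by rewrite !big_ord0 expr0 subrr mulr0 addr0.
rewrite !big_ord_recr /= mulnS !natrD.
have hB : (B * (W %/ period B))%:R <= W%:R / C%:R * 2^-1 ^+ B.+1 :> R.
  rewrite exprVn -mulrA -invfM ler_pdivlMr; last by rewrite mulr_gt0 // exprn_gt0.
  rewrite -natrX -!natrM ler_nat -/(block_rank B).
  apply: leq_trans (leq_divM W (period B)).
  by rewrite [X in (_ <= X)%N]mulnA [(_ * B.+1)%N]mulnC !leq_mul2r leqnSn !orbT.
have e2 : 2^-1 ^+ B = 2 * 2^-1 ^+ B.+1 :> R by rewrite exprS mulVKf // pnatr_eq0.
move: IH hB; rewrite e2; set p := 2^-1 ^+ B.+1; set K := W%:R / C%:R.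
by rewrite !mulrBr mulrA [K * 2]mulrC -mulrA mulr1; lra.
Qed.

Lemma mdim_code (d : Y -> Y -> R) (delta : R) : compatible_metric d ->
  C%:R^-1 < delta -> (mdim S d < delta%:E)%E.
Proof.
move=> dc Cdelta; have C0 : 0 < C%:R^-1 :> R by rewrite invr_gt0 ltr0n.
(* Limits preserve only weak inequalities, whence a bound strictly between [C%:R^-1] and [delta].
   The numbers [B] and [M] found below depend on [e] but affect only the constant term. *)
pose c := (C%:R^-1 + delta) / 2.
have Cc : C%:R^-1 < c by rewrite /c; lra.
apply: (@le_lt_trans _ _ c%:E); last by rewrite lte_fin /c; lra.
have c0 : (0 <= c%:E)%E by rewrite lee_fin ltW // (lt_trans C0).
apply: lim_le_near => //; near=> e.
have e_gt0 : 0 < e by near: e; exact: nbhs_right_gt.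
have [B [M wle]] := widim_code_le dc e_gt0.
apply: lim_le_near => //.
apply: (@near_ratio_le _ _ C%:R^-1 ((2 * M)%N%:R / C%:R + (\sum_(n < B) n)%N%:R)) => // L.
apply: le_trans (wle L) _; rewrite lee_fin; apply: le_trans (code_rank_le _ _) _.
by rewrite natrD mulrDl addrA [C%:R^-1 * _]mulrC.
Unshelve. all: by end_near.
Qed.

Lemma rel_mdim_code (d : X -> X -> R) : compatible_metric d ->
  rel_mdim T code_factor d = 0%E.
Proof.
move=> dc; apply: lim_near_cst => //; near=> e.
have e_gt0 : 0 < e by near: e; exact: nbhs_right_gt.
have [M [n0 wle]] := widim_fibre_le dc e_gt0.
pose v L := ereal_sup
  [set widim (orbit_metric T d L) e (code_factor @^-1` [set y]) | y in [set: Y]].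
have v_ge0 L : (0 <= v L)%E.
  (* A point of [Y] is exhibited because the supremum over an empty set would be [-oo]. *)
  pose x0 : X := cube_point 0 ([ffun=> 0%N] : {ffun 'I_0 -> nat}).
  apply: le_trans (widim_ge0 (orbit_metric T d L) e (code_factor @^-1` [set code_factor x0])) _.
  by apply: ereal_sup_ubound; exists (code_factor x0).
apply: cvg_lim => //; apply: (@cvge_sandwich _ _ _ _ 0) => eps eps0.
have [n1 _ n1P] := near_infty_natSinv_lt (PosNum eps0).
(* The scale [e] bounds [n] only from below, and the width grows with slope at most [n.+1%:R^-1]. So
   the limit over [L] is 0 for every [e]. *)
pose n := maxn n0 n1.
have n_eps : n.+1%:R^-1 < eps by apply: (n1P n); rewrite /= leq_maxr.
have h1 : \forall L \near \oo, (v L / (L%:R)%:E <= eps%:E)%E.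
  apply: (@near_ratio_le _ _ n.+1%:R^-1
    ((2 * M)%N%:R / n.+1%:R + (2 * block_rank n)%N%:R)) => // L.
  apply: ge_ereal_sup => _ [y _ <-].
  apply: le_trans (wle n L y (leq_maxl _ _)) _; rewrite lee_fin.
  rewrite addrA [n.+1%:R^-1 * _]mulrC -mulrDl -natrD -addn2 mulnDl natrD lerD2r.
  rewrite ler_pdivlMr ?ltr0n // -natrM ler_nat.
  by rewrite -mulnA [(block_rank n * _)%N]mulnC leq_divM.
have h2 : \forall L \near \oo, (0 <= v L / (L%:R)%:E)%E.
  near=> L; have L0 : (0 < L)%N by near: L; exact: nbhs_infty_gt.
  by rewrite inve_nat // mule_ge0 // lee_fin invr_ge0.
apply: filterS2 h1 h2 => L h1 h2; rewrite !add0r h1 andbT.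
by apply: le_trans h2; rewrite lee_fin oppr_le0 ltW.
Unshelve. all: by end_near.
Qed.

End Systems.

Theorem theorem1p3 (R : realType) (delta : R) (hdelta : 0 < delta) :
  exists (X Y : topologicalType) (T : X -> X) (S : Y -> Y) (pi : X -> Y),
    [/\ dynamical_system R T,
        dynamical_system R S,
        factor_map T S pi &
        forall (dX : X -> X -> R) (dY : Y -> Y -> R),
          compatible_metric dX -> compatible_metric dY ->
          [/\ mdim T dX = 1%E,
              (mdim S dY < delta%:E)%E &
              rel_mdim T pi dX = 0%E]].
Proof.
(* Chosen to exceed [delta^-1], since the mean dimension of the factor is at most [1 / C]. *)
pose C := (Num.truncn delta^-1).+1.
have C_gt0 : (0 < C)%N by [].
have C_delta : C%:R^-1 < delta.
  by rewrite invf_plt ?posrE ?ltr0n //; exact: truncnS_gt.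
exists (set_type (@marked_set R C)), (set_type (@code_set R C)),
  (shift_on (marked_set_shift C_gt0) 1), (shift_on (code_set_shift C_gt0) 1),
  (@code_factor R C).
split.
- apply: subshift_dynamical_system; first exact: marked_set_compact.
  by move=> w p; exact: marked_set_itv.
- apply: subshift_dynamical_system; first exact: code_set_compact.
  by move=> w p; exact: code_set_itv.
- exact: code_factor_map.
- move=> dX dY dXc dYc; split.
  + exact: mdim_marked.
  + exact: mdim_code.
  + exact: rel_mdim_code.
Qed.
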